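(* Let $(X,d)$ be an infinite, compact, finite Nagata-dimensional metric space. Then for every $\alpha \in (0,1)$, the metric space $(X,d^\alpha)$ admits, for every choice of basepoint, a stochastic biLipschitz embedding into a pointed ultrametric space, and $\mathrm{LF}(X,d^\alpha) \approx \ell^1$.
   Context: A metric space $(X,d)$ has Nagata dimension $n\in\mathbb{N}=\{0,1,2,\dots\}$ with constant $\gamma<\infty$ if for every $s>0$ there is a cover $\mathcal{C}$ of $X$ such that $\mathrm{diam}(C)\le\gamma s$ for all $C\in\mathcal{C}$ and every $A\subseteq X$ with $\mathrm{diam}(A)\le s$ meets at most $n+1$ members of $\mathcal{C}$. It is finite Nagata-dimensional if such $n,\gamma$ exist. $d^\alpha(x,y):=d(x,y)^\alpha$. A pointed metric space is a metric space with a distinguished basepoint. A random map $\phi=\{\phi_\omega:X\to Y\}_{\omega\in\Omega}$ between pointed metric spaces $(X,d_X,x_0)$, $(Y,d_Y,y_0)$ is a family of maps indexed by a probability space $(\Omega,\mathcal{F},\mathbb{P})$ such that: for every $x\in X$, $\omega\mapsto\phi_\omega(x)$ is measurable (Borel $\sigma$-algebra on $Y$); for every $x\in X$ there are a separable $S\subseteq Y$ and a $\mathbb{P}$-null set $N$ with $\phi_\omega(x)\in S$ for all $\omega\in\Omega\setminus N$; and $\phi_\omega(x_0)=y_0$ for almost every $\omega$. It is a stochastic biLipschitz embedding of distortion $D<\infty$ and scaling factor $s\in(0,\infty)$ if for all $x,y\in X$: $\mathbb{E}_\omega[d_Y(\phi_\omega(x),\phi_\omega(y))]\le sD\,d_X(x,y)$,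 and $d_Y(\phi_\omega(x),\phi_\omega(y))\ge s\,d_X(x,y)$ for almost every $\omega$. A stochastic biLipschitz embedding is one for some $D,s$. An ultrametric space is a metric space with $d(u,w)\le\max\{d(u,v),d(v,w)\}$ for all $u,v,w$. For a pointed metric space $X$, $\mathrm{Lip}_0(X)$ is the Banach space of real Lipschitz functions vanishing at the basepoint, normed by the Lipschitz constant; the Lipschitz free space $\mathrm{LF}(X)$ (also written $\mathrm{LF}(X,d)$; its isometry type does not depend on the basepoint) is the closed linear span in $\mathrm{Lip}_0(X)^*$ of the evaluation functionals $\delta_x$, $x\in X$. $V\approx W$ means that the real Banach spaces $V,W$ are isomorphic (bounded linear isomorphism). $\ell^1=\ell^1(\mathbb{N})$. *)

(* Defs.v *)
From HB Require Import structures.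
From mathcomp Require Import all_boot all_order all_algebra.
From mathcomp Require Import all_classical all_reals all_analysis.

Set Implicit Arguments.
Unset Strict Implicit.
Unset Printing Implicit Defensive.

Import Order.TTheory GRing.Theory Num.Theory.
Import numFieldNormedType.Exports.

Local Open Scope classical_set_scope.
Local Open Scope ring_scope.

Section Nagata.
Context {R : realType} (X : metricType R).

(* The join with 0 fixes diam set0 = 0. *)
Definition diam (A : set X) : \bar R :=
  Order.max 0%E (ereal_sup [set (mdist p.1 p.2)%:E | p in A `*` A]).

Definition has_nagata_dim (n : nat) (gamma : R) : Prop :=
  forall s : R, 0 < s ->
  exists C : set (set X),
    [/\ \bigcup_(B in C) B = [set: X],
        forall B, C B -> (diam B <= (gamma * s)%:E)%E &
        forall A : set X, (diam A <= s%:E)%E ->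
          ([set B | C B /\ A `&` B !=set0] #<= `I_n.+1)%card].

Definition finite_nagata_dim : Prop :=
  exists (n : nat) (gamma : R), has_nagata_dim n gamma.

End Nagata.

Section Snowflake.
Context {R : realType}.

(* The metric space (X, d^a): the carrier of X with the distance
   mdist x y `^ a given by the instance below. *)
Definition snowflake (X : metricType R) (a : R) (a01 : 0 < a < 1) : Type := X.

Context (X : metricType R) (a : R) (a01 : 0 < a < 1).

HB.instance Definition _ := Choice.on (snowflake X a01).

Let sdist (x y : snowflake X a01) : R := (@mdist R X x y) `^ a.

Let sdistxx x : sdist x x = 0.
Proof. by rewrite /sdist mdistxx powR0// gt_eqF//; case/andP: a01. Qed.

Let sdist_positivity x y : sdist x y = 0 -> x = y.
Proof. by move=> /powR_eq0_eq0; exact: mdist_positivity. Qed.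

Let sdist_sym x y : sdist x y = sdist y x.
Proof. by rewrite /sdist metric_sym. Qed.

Let powR_subadd (u v : R) : 0 <= u -> 0 <= v ->
  (u + v) `^ a <= u `^ a + v `^ a.
Proof.
case/andP: a01 => a0 a1 u0 v0.
have [uv0|uv0] := leP (u + v) 0.
  have -> : u + v = 0 by apply/eqP; rewrite eq_le uv0 addr_ge0.
  by rewrite powR0 ?gt_eqF// addr_ge0// powR_ge0.
set w := u + v in uv0 *.
have key t : 0 <= t -> t <= w -> t / w * w `^ a <= t `^ a.
  move=> t0 tw; have [t_gt0|] := ltP 0 t; last first.
    by move=> t_le0; rewrite (le_trans _ (powR_ge0 _ _))// mulr_le0_ge0 ?powR_ge0//
      mulr_le0_ge0// invr_ge0 ltW.
  rewrite -[in leRHS](@divfK _ w _ t) ?gt_eqF// powRM ?divr_ge0 ?(ltW uv0)//.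
  rewrite ler_wpM2r ?powR_ge0//.
  rewrite -[leLHS]powRr1 ?divr_ge0 ?(ltW uv0)//.
  by apply: ger_powR; rewrite ?(ltW a1)// divr_gt0//= ler_pdivrMr// mul1r.
apply: le_trans (lerD (key u u0 _) (key v v0 _)); last 2 first.
- by rewrite /w lerDl.
- by rewrite /w lerDr.
by rewrite -mulrDl -mulrDl -/w divff ?gt_eqF// mul1r.
Qed.

Let sdist_triangle y x z : sdist x z <= sdist x y + sdist y z.
Proof.
apply: le_trans (powR_subadd (mdist_ge0 _ _) (mdist_ge0 _ _)).
case/andP: a01 => a0 _.
by rewrite ge0_ler_powR ?nnegrE ?addr_ge0 ?mdist_ge0 ?metric_triangle// ltW.
Qed.

HB.instance Definition _ := @isMetric.Build R (snowflake X a01) sdist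
  sdistxx sdist_positivity sdist_sym sdist_triangle.

Lemma snowflake_mdist (x y : X) :
  @mdist R (snowflake X a01) x y = (@mdist R X x y) `^ a.
Proof. by []. Qed.

End Snowflake.

Section StochasticEmbedding.
Context {R : realType}.

Definition ultrametric (Y : metricType R) : Prop :=
  forall u v w : Y, mdist u w <= Order.max (mdist u v) (mdist v w).

Definition separable_set (Y : metricType R) (S : set Y) : Prop :=
  exists2 E : set Y, countable E & E `<=` S /\ S `<=` closure E.

Definition random_map d (Omega : measurableType d) (P : probability Omega R)
    (X : metricType R) (x0 : X) (Y : metricType R) (y0 : Y)
    (phi : Omega -> X -> Y) : Prop :=
  [/\ forall (x : X) (B : set Y), <<s @open Y >> B ->
        measurable [set w | B (phi w x)],
      forall x : X, exists2 S : set Y, separable_set S &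
        {ae P, forall w, S (phi w x)} &
      {ae P, forall w, phi w x0 = y0}].

(* The displacement of a random map is measurable up to a null set, because
   the map is a.e. separably valued; the integral of the library is insensitive
   to such a modification of a nonnegative function. *)
Definition stochastic_biLipschitz d (Omega : measurableType d)
    (P : probability Omega R) (X Y : metricType R) (phi : Omega -> X -> Y)
    (D s : R) : Prop :=
  forall x y : X,
    ('E_P[fun w => mdist (phi w x) (phi w y)] <= (s * D * mdist x y)%:E)%E /\
    {ae P, forall w, s * mdist x y <= mdist (phi w x) (phi w y)}.

Definition stochastic_embeds (X : metricType R) (x0 : X)
    (Y : metricType R) (y0 : Y) : Prop :=
  exists (d : measure_display) (Omega : measurableType d)
      (P : probability Omega R) (phi : Omega -> X -> Y) (D s : R),
    [/\ random_map P x0 y0 phi, 0 < s & stochastic_biLipschitz P phi D s].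

End StochasticEmbedding.

Section LeastConst.
Context {R : realType} (I : Type).
Implicit Types a b : I -> R.

(* The least k >= 0 with a i <= k * b i for all i: the Lipschitz constant for
   a (x, y) = |f x - f y| and b = mdist, the operator norm for a v = |f v| and
   b v = |v|. The constraint 0 <= k only matters when b vanishes identically
   (one-point metric space, zero normed space). *)
Definition bounding_const a b : set R :=
  [set k | 0 <= k /\ forall i, a i <= k * b i].

Definition least_const a b : R := inf (bounding_const a b).

Lemma least_const_ge0 a b : 0 <= least_const a b.
Proof.
rewrite /least_const; have [->|/set0P ne] := eqVneq (bounding_const a b) set0.
  by rewrite inf0.
by apply: lb_le_inf => // k [].
Qed.

Lemma least_const_le a b k : bounding_const a b k -> least_const a b <= k.
Proof. by move=> ak; apply: ge_inf => //; exists 0 => c []. Qed.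

Lemma least_constP a b : (forall i, 0 <= b i) ->
  bounding_const a b !=set0 -> forall i, a i <= least_const a b * b i.
Proof.
move=> b0 ne i; have [bi|bi] := leP (b i) 0.
  have bi0 : b i = 0 by apply/eqP; rewrite eq_le bi b0.
  by case: ne => k [_ /(_ i)]; rewrite bi0 !mulr0.
rewrite -ler_pdivrMr//; apply: lb_le_inf => // k [_ /(_ i)].
by rewrite ler_pdivrMr.
Qed.

Section scaling.
Context (V : lmodType R) (F : V -> I -> R) (b : I -> R).
Context (b0 : forall i, 0 <= b i).
Context (F_bounded : forall v, bounding_const (F v) b !=set0).

Lemma least_constD : (forall u v i, F (u + v) i <= F u i + F v i) ->
  forall u v, least_const (F (u + v)) b <= least_const (F u) b + least_const (F v) b.
Proof.
move=> FD u v; apply: least_const_le; split.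
  by rewrite addr_ge0 ?least_const_ge0.
by move=> i; rewrite mulrDl (le_trans (FD _ _ _))// lerD ?least_constP.
Qed.

Lemma least_constZ : (forall l v i, F (l *: v) i = `|l| * F v i) ->
  forall l v, least_const (F (l *: v)) b = `|l| * least_const (F v) b.
Proof.
move=> FZ.
have le l v : least_const (F (l *: v)) b <= `|l| * least_const (F v) b.
  apply: least_const_le; split; first by rewrite mulr_ge0 ?least_const_ge0.
  by move=> i; rewrite FZ -mulrA ler_wpM2l ?least_constP.
move=> l v; apply/eqP; rewrite eq_le le/=.
have [->|l0] := eqVneq l 0; first by rewrite normr0 mul0r least_const_ge0.
rewrite -ler_pdivlMl ?normr_gt0//.
have := le l^-1 (l *: v).
by rewrite scalerA mulVf// scale1r normfV.
Qed.

Lemma least_const_eq0 v : least_const (F v) b = 0 -> forall i, F v i <= 0.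
Proof. by move=> v0 i; rewrite (le_trans (least_constP b0 _ i))// v0 mul0r. Qed.

End scaling.
End LeastConst.

Section Lip0.
Context {R : realType} {X : metricType R} (x0 : X).

Definition is_lip0 : {pred X -> R^o} := fun f =>
  `[< f x0 = 0 /\ exists k : R, forall x y, `|f x - f y| <= k * mdist x y >].

Let lip0_submod : submod_closed is_lip0.
Proof.
split.
  apply/asboolP; split => //; exists 0 => x y.
  by rewrite subrr normr0 mul0r.
move=> l f g /asboolP[f0 [k fk]] /asboolP[g0 [k' gk]].
apply/asboolP; split.
  have -> : (l *: f + g) x0 = l * f x0 + g x0 by [].
  by rewrite f0 g0 mulr0 addr0.
exists (`|l| * k + k') => x y.
have -> : (l *: f + g) x - (l *: f + g) y = l * (f x - f y) + (g x - g y).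
  have E z : (l *: f + g) z = l * f z + g z by [].
  by rewrite !E mulrBr opprD addrACA.
by rewrite mulrDl (le_trans (ler_normD _ _))// lerD// normrM -mulrA ler_wpM2l.
Qed.

HB.instance Definition _ := GRing.isSubmodClosed.Build R (X -> R^o) is_lip0 lip0_submod.

Record lip0 := Lip0 { lip0_fun :> X -> R^o ; _ : lip0_fun \in is_lip0 }.

HB.instance Definition _ := [isSub of lip0 for lip0_fun].
HB.instance Definition _ := [Choice of lip0 by <:].
HB.instance Definition _ := [SubChoice_isSubLmodule of lip0 by <:].

Lemma lip0_base (f : lip0) : f x0 = 0.
Proof. by case: f => f /= /asboolP[]. Qed.

Definition lip_const (f : lip0) : R :=
  least_const (fun p : X * X => `|f p.1 - f p.2|) (fun p => mdist p.1 p.2).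

Let F (f : lip0) (p : X * X) : R := `|f p.1 - f p.2|.
Let b (p : X * X) : R := mdist p.1 p.2.

Let b0 p : 0 <= b p. Proof. exact: mdist_ge0. Qed.

Let F_bounded f : bounding_const (F f) b !=set0.
Proof.
case: f => f fl; case/asboolP: (fl) => _ [k fk]; exists `|k|; split => // p.
by rewrite (le_trans (fk _ _))// ler_wpM2r ?mdist_ge0// ler_norm.
Qed.

Lemma lip_constP (f : lip0) x y : `|f x - f y| <= lip_const f * mdist x y.
Proof. exact: (least_constP b0 (F_bounded f) (x, y)). Qed.

Let lip_constD f g : lip_const (f + g) <= lip_const f + lip_const g.
Proof.
apply: (least_constD b0 F_bounded) => {}f {}g p.
have -> : F (f + g) p = `|(f p.1 - f p.2) + (g p.1 - g p.2)|.
  by rewrite addrACA -opprD.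
exact: ler_normD.
Qed.

Let lip_constZ l f : lip_const (l *: f) = `|l| * lip_const f.
Proof.
apply: (least_constZ b0 F_bounded) => {}l {}f p.
have -> : F (l *: f) p = `|l * f p.1 - l * f p.2| by [].
by rewrite -mulrBr normrM.
Qed.

Let lip_const_eq0 f : lip_const f = 0 -> f = 0.
Proof.
move=> /(least_const_eq0 b0 F_bounded) f0.
apply/val_inj/funext => x /=; have := f0 (x, x0).
by rewrite /F /= normr_le0 lip0_base subr0 => /eqP.
Qed.

HB.instance Definition _ :=
  Lmodule_isNormed.Build R lip0 lip_constD lip_constZ lip_const_eq0.

Lemma lip0_normE (f : lip0) : `|f| = lip_const f. Proof. by []. Qed.

End Lip0.

Section Dual.
Context {R : realType} (V : normedModType R).

Definition is_dual : {pred V -> R^o} := fun f =>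
  `[< linear f /\ continuous f >].

Let dual_submod : submod_closed is_dual.
Proof.
split.
  apply/asboolP; split; last by move=> x; exact: cvg_cst.
  by move=> l u v; rewrite /= scaler0 addr0.
move=> l f g /asboolP[fl fc] /asboolP[gl gc]; apply/asboolP; split.
  move=> k u v.
  have E z : (l *: f + g) z = l *: f z + g z by [].
  rewrite !E fl gl !scalerDr !scalerA [k * l]mulrC.
  by rewrite addrACA.
move=> x; apply: (@cvgD _ R^o); last exact: gc.
by apply: (@cvgZl_tmp _ R^o) => //; exact: fc.
Qed.

HB.instance Definition _ := GRing.isSubmodClosed.Build R (V -> R^o) is_dual dual_submod.

Record dual_space := Dual { dual_fun :> V -> R^o ; _ : dual_fun \in is_dual }.

HB.instance Definition _ := [isSub of dual_space for dual_fun].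
HB.instance Definition _ := [Choice of dual_space by <:].
HB.instance Definition _ := [SubChoice_isSubLmodule of dual_space by <:].

Definition op_norm (f : dual_space) : R :=
  least_const (fun v : V => `|f v|) (fun v => `|v|).

Let F (f : dual_space) (v : V) : R := `|f v|.
Let b (v : V) : R := `|v|.

Let b0 v : 0 <= b v. Proof. exact: normr_ge0. Qed.

Let F_bounded f : bounding_const (F f) b !=set0.
Proof.
case: f => f fd; case/asboolP: (fd) => fl fc.
pose fL : {linear V -> R^o} :=
  HB.pack f (GRing.isLinear.Build R V R^o *:%R f fl).
have : bounded_near fL (nbhs (0 : V)).
  by apply: continuous_linear_bounded; exact: fc.
move=> /linear_boundedP/pinfty_ex_gt0[M M0 fM].
by exists M; split; [exact: ltW|exact: fM].
Qed.

Let op_normD f g : op_norm (f + g) <= op_norm f + op_norm g.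
Proof. by apply: (least_constD b0 F_bounded) => {}f {}g v; exact: ler_normD. Qed.

Let op_normZ l f : op_norm (l *: f) = `|l| * op_norm f.
Proof. by apply: (least_constZ b0 F_bounded) => {}l {}f v; exact: normrM. Qed.

Let op_norm_eq0 f : op_norm f = 0 -> f = 0.
Proof.
move=> /(least_const_eq0 b0 F_bounded) f0.
by apply/val_inj/funext => v /=; apply/eqP; rewrite -normr_le0; exact: f0.
Qed.

HB.instance Definition _ :=
  Lmodule_isNormed.Build R dual_space op_normD op_normZ op_norm_eq0.

Lemma dual_normE (f : dual_space) : `|f| = op_norm f. Proof. by []. Qed.

End Dual.

Section LinearSpan.
Context {R : realType} {V : normedModType R}.

Definition lin_span (A : set V) : set V :=
  [set v | exists (n : nat) (c : 'I_n -> R) (u : 'I_n -> V),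
     (forall i, A (u i)) /\ v = \sum_(i < n) c i *: u i].

Lemma lin_span_comb (A : set V) (l : R) u v :
  lin_span A u -> lin_span A v -> lin_span A (l *: u + v).
Proof.
move=> [m [c [w [Aw ->]]]] [n [c' [w' [Aw' ->]]]].
pose cc (i : 'I_m + 'I_n) := match i with inl j => l * c j | inr j => c' j end.
pose ww (i : 'I_m + 'I_n) := match i with inl j => w j | inr j => w' j end.
exists (m + n)%N, (cc \o fintype.split), (ww \o fintype.split); split.
  by move=> i; rewrite /ww /=; case: (fintype.split i).
rewrite big_split_ord/= scaler_sumr; congr (_ + _); apply: eq_bigr => i _.
  by rewrite (unsplitK (inl i)) /= scalerA.
by rewrite (unsplitK (inr i)).
Qed.

End LinearSpan.

Section FreeSpace.
Context {R : realType} {X : metricType R} (x0 : X).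

Let eval_is_dual (x : X) : (fun f : lip0 x0 => f x : R^o) \in @is_dual R (lip0 x0).
Proof.
have ev_linear : linear (fun f : lip0 x0 => f x : R^o) by [].
apply/asboolP; split => //.
pose ev : {linear lip0 x0 -> R^o} :=
  HB.pack (fun f : lip0 x0 => f x : R^o)
    (GRing.isLinear.Build R (lip0 x0) R^o *:%R _ ev_linear).
apply: (@bounded_linear_continuous R (lip0 x0) R^o ev).
apply/linear_boundedP; exists (mdist x x0); split; first exact: num_real.
move=> r xr f; have := lip_constP f x x0; rewrite lip0_base subr0.
by move=> /le_trans; apply; rewrite mulrC ler_wpM2r ?least_const_ge0// ltW.
Qed.

Definition delta (x : X) : dual_space (lip0 x0) := Dual (eval_is_dual x).

(* The Lipschitz free space: norm closure, in the dual of lip0 x0, of the span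
   of the evaluations; it carries the norm of the dual. *)
Definition is_free : {pred dual_space (lip0 x0)} := fun phi =>
  `[< closure (lin_span (range delta)) phi >].

Let free_submod : submod_closed is_free.
Proof.
split.
  apply/asboolP/subset_closure; exists 0%N, (fun=> 0), (fun=> 0); split.
    by case.
  by rewrite big_ord0.
move=> l u v /asboolP Au /asboolP Av; apply/asboolP => B.
have cvg_comb : (fun p : dual_space (lip0 x0) * dual_space (lip0 x0) => l *: p.1 + p.2) @ (u, v) -->
    l *: u + v.
  apply: cvgD; last exact: cvg_snd.
  by apply: cvgZl_tmp; exact: cvg_fst.
move=> /cvg_comb[[/= U W] [Uu Wv] UW].
have [u' [Au' Uu']] := Au _ Uu; have [v' [Av' Wv']] := Av _ Wv.
by exists (l *: u' + v'); split; [exact: lin_span_comb|exact: (UW (u', v'))].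
Qed.

HB.instance Definition _ :=
  GRing.isSubmodClosed.Build R (dual_space (lip0 x0)) is_free free_submod.

Record free_space := FreeSpace
  { free_fun :> dual_space (lip0 x0) ; _ : free_fun \in is_free }.

HB.instance Definition _ := [isSub of free_space for free_fun].
HB.instance Definition _ := [Choice of free_space by <:].
HB.instance Definition _ := [SubChoice_isSubLmodule of free_space by <:].

Let fnorm (u : free_space) : R := `|free_fun u|.

Let fnormD u v : fnorm (u + v) <= fnorm u + fnorm v.
Proof. exact: ler_normD. Qed.

Let fnormZ l u : fnorm (l *: u) = `|l| * fnorm u.
Proof. exact: normrZ. Qed.

Let fnorm_eq0 u : fnorm u = 0 -> u = 0.
Proof. by move=> /normr0_eq0 u0; exact: val_inj. Qed.

HB.instance Definition _ :=
  Lmodule_isNormed.Build R free_space fnormD fnormZ fnorm_eq0.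

Lemma free_normE (u : free_space) : `|u| = `|free_fun u|. Proof. by []. Qed.

End FreeSpace.

Section Ell1.
Context {R : realType}.

Definition is_ell1 : {pred nat -> R^o} := fun u =>
  `[< cvgn [normed series u] >].

Let ell1_submod : submod_closed is_ell1.
Proof.
split.
  apply/asboolP; rewrite (_ : [normed series _] = cst 0); first exact: is_cvg_cst.
  by apply/funext => n; apply: big1 => i _; exact: normr0.
move=> l u v /asboolP cu /asboolP cv; apply/asboolP.
pose w : R^nat := `|l| *: (fun n => `|u n| : R^o) + (fun n => `|v n| : R^o).
apply: (@series_le_cvg _ _ w) => [n|n|n|].
- exact: normr_ge0.
- by rewrite /w addr_ge0 ?mulr_ge0.
- by rewrite /w (le_trans (ler_normD _ _))// lerD// normrM.
- by apply: is_cvg_seriesD => //; exact: is_cvg_seriesZ.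
Qed.

HB.instance Definition _ := GRing.isSubmodClosed.Build R (nat -> R^o) is_ell1 ell1_submod.

Record ell1 := Ell1 { ell1_fun :> nat -> R^o ; _ : ell1_fun \in is_ell1 }.

HB.instance Definition _ := [isSub of ell1 for ell1_fun].
HB.instance Definition _ := [Choice of ell1 by <:].
HB.instance Definition _ := [SubChoice_isSubLmodule of ell1 by <:].

Definition ell1_norm (u : ell1) : R := limn [normed series u].

Let nrm (u : ell1) : R^nat := fun n => `|u n|.

Let ell1_cvg (u : ell1) : cvgn (series (nrm u)).
Proof. by case: u => u ul; move/asboolP: (ul). Qed.

Let ell1_normD u v : ell1_norm (u + v) <= ell1_norm u + ell1_norm v.
Proof.
change (limn (series (nrm (u + v))) <= limn (series (nrm u)) + limn (series (nrm v))).
have <- := @lim_seriesD R _ _ (@ell1_cvg u) (@ell1_cvg v).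
apply: (@lim_series_le R (nrm (u + v)) (fun n => nrm u n + nrm v n)).
- exact: ell1_cvg.
- exact: (@is_cvg_seriesD R (nrm u) (nrm v)).
- by move=> n; exact: ler_normD.
Qed.

Let ell1_normZ l u : ell1_norm (l *: u) = `|l| * ell1_norm u.
Proof.
change (limn (series (nrm (l *: u))) = `|l| * limn (series (nrm u))).
have -> : nrm (l *: u) = `|l| *: (nrm u : nat -> R^o).
  by apply/funext => n; exact: normrM.
exact: (@lim_seriesZ R _ _ (@ell1_cvg u)).
Qed.

Let ell1_norm_eq0 u : ell1_norm u = 0 -> u = 0.
Proof.
move=> u0; apply/val_inj/funext => n /=; apply/eqP; rewrite -normr_le0.
have nd : nondecreasing_seq (series (nrm u)).
  by apply/nondecreasing_seqP => k; rewrite /series/= big_nat_recr//= lerDl normr_ge0.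
have : series (nrm u) n.+1 <= 0.
  by rewrite -[leRHS]u0; exact: (nondecreasing_cvgn_le nd (@ell1_cvg u)).
apply: le_trans; rewrite /series/= big_nat_recr//= lerDr.
by apply: sumr_ge0 => i _; exact: normr_ge0.
Qed.

HB.instance Definition _ :=
  Lmodule_isNormed.Build R ell1 ell1_normD ell1_normZ ell1_norm_eq0.

Lemma ell1_normE (u : ell1) : `|u| = limn [normed series u].
Proof. by []. Qed.

End Ell1.
Arguments ell1 : clear implicits.

Definition isomorphic {R : realType} (V W : normedModType R) : Prop :=
  exists (f : {linear V -> W}) (g : {linear W -> V}),
    [/\ continuous f, continuous g, cancel f g & cancel g f].

(* Main.v *)
From HB Require Import structures.
Require Import Defs.
From mathcomp Require Import all_boot all_order all_algebra finmap.
From mathcomp Require Import all_classical all_reals all_analysis.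
From mathcomp Require Import measurable_realfun.
From mathcomp Require Import ring lra.

(** The proof rests on one multiscale object, a system of cells. At scale 2^-k the
Nagata dimension gives a cover of X by cells of diameter O(2^-k), finitely many by
compactness, such that every ball of radius comparable to 2^-k meets boundedly many
of them. Let u k i be the distance to the i-th cell in units of 2^-k, truncated at 1.
Only boundedly many of the u k i change near a point, so for d(p, q) <= 2^-k the
vectors (u k i p)_i and (u k i q)_i are within O(2^k d(p, q)) of each other in l1
([nagata_cell_system]). Everything else uses these functions only, together with
the estimate
    sum_k 2^(- k alpha) min(1, 2^k t) <= G t^alpha,
where alpha < 1 tames the small k and alpha > 0 the large k ([snowflake_sum]).

Ultrametric embedding. Draw one threshold w uniformly in [0, 1] and let the k-th
letter of the code of p be the first i with u k i p <= w. Codes are infinite words,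
at distance 2^(- k alpha) when their first difference is at k; this is an
ultrametric. The letters of p and q at level k differ only if w separates u k i p
from u k i q for some i, which has probability O(min(1, 2^k d(p, q))); summing over
k with the weights 2^(- k alpha) bounds the expected distance by O(d(p, q)^alpha).
Linearity of the expectation is all that is used about the levels, hence a single w
serves all of them. Conversely, points with the same letter at level k lie near the
same cell, hence at distance O(2^-k), which is the almost sure lower bound
([snowflake_stochastic_embeds]).

Free space. The probability that the k-th letter of p is i is a partition of unity
phi k i, and the averages m_k p = sum_i phi k i p delta_(b k i) over representatives
b k i of the cells tend to delta_p. Level 0 has a single cell, represented by the
basepoint, so m_0 p = 0 and
    delta_p = sum_k (m_(k+1) p - m_k p)
            = sum_(k, i, j) phi (k+1) i p phi k j p (delta_(b (k+1) i) - delta_(b k j)).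
The differences that occur have norm O(2^(- k alpha)), and by [snowflake_sum] the
coefficients, multiplied by 2^(- k alpha), are the coordinates of a Lipschitz map
from (X, d^alpha) to l1. Thus the identity of LF(X, d^alpha) factors through l1
([free_space_retract_ell1]). In the other direction, an infinite compact space has an
accumulation point p, and the normalized differences of delta_p with the point
evaluations along a rapidly converging sequence span a complemented copy of l1 in the
free space ([ell1_complemented_accumulation]). Pelczynski's decomposition method turns
the two factorizations into an isomorphism ([pelczynski_ell1]). *)

Set Implicit Arguments.
Unset Strict Implicit.
Unset Printing Implicit Defensive.

Import Order.TTheory GRing.Theory Num.Theory.
Import numFieldNormedType.Exports.

Local Open Scope classical_set_scope.
Local Open Scope ring_scope.

(** * Bounded linear operators *)

Section bounded_operators.
Context {R : realType}.
Implicit Types U V W : normedModType R.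

(** Plain functions with a predicate, so that the operators below can be composed
and added without rebuilding a linear structure each time; the structures are
packed once, in [isomorphic_bounded_op]. *)
Definition bounded_op V W (f : V -> W) : Prop :=
  linear f /\ exists C : R, forall v, `|f v| <= C * `|v|.

Lemma bounded_op_id V : bounded_op (@id V).
Proof. by split=> //; exists 1 => v; rewrite mul1r. Qed.

Lemma bounded_op_comp U V W (f : V -> W) (g : U -> V) :
  bounded_op f -> bounded_op g -> bounded_op (fun u => f (g u)).
Proof.
move=> [lf [C Cf]] [lg [D Dg]]; split; first by move=> k u v; rewrite lg lf.
exists (`|C| * D) => u; apply: le_trans (Cf _) _.
apply: le_trans (_ : `|C| * `|g u| <= _); first by rewrite ler_wpM2r// ler_norm.
by rewrite -mulrA ler_wpM2l.
Qed.

Lemma bounded_opD V W (f g : V -> W) :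
  bounded_op f -> bounded_op g -> bounded_op (fun u => f u + g u).
Proof.
move=> [lf [C Cf]] [lg [D Dg]]; split.
  by move=> k u v; rewrite lf lg scalerDr addrACA.
by exists (C + D) => u; rewrite mulrDl (le_trans (ler_normD _ _))// lerD.
Qed.

Lemma bounded_opB V W (f g : V -> W) :
  bounded_op f -> bounded_op g -> bounded_op (fun u => f u - g u).
Proof.
move=> [lf [C Cf]] [lg [D Dg]]; split.
  by move=> k u v; rewrite lf lg scalerBr opprD addrACA.
by exists (C + D) => u; rewrite mulrDl (le_trans (ler_normB _ _))// lerD.
Qed.

Lemma bounded_opB1 V W (f : V -> W) : bounded_op f -> forall u v, f (u - v) = f u - f v.
Proof. by move=> [lf _] u v; rewrite addrC -scaleN1r lf scaleN1r addrC. Qed.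

Lemma bounded_opD1 V W (f : V -> W) : bounded_op f -> forall u v, f (u + v) = f u + f v.
Proof. by move=> [lf _] u v; rewrite -{1}[u]scale1r lf scale1r. Qed.

Lemma bounded_opZ1 V W (f : V -> W) : bounded_op f -> forall k u, f (k *: u) = k *: f u.
Proof.
move=> bf k u; have f0 : f 0 = 0 by rewrite -(subrr 0) (bounded_opB1 bf) subrr.
by case: bf => lf _; rewrite -[k *: u]addr0 lf f0 addr0.
Qed.

Lemma bounded_op_bound V W (f : V -> W) : bounded_op f ->
  exists2 C : R, 0 <= C & forall v, `|f v| <= C * `|v|.
Proof.
move=> [_ [C Cf]]; exists `|C| => // v.
by rewrite (le_trans (Cf v))// ler_wpM2r// ler_norm.
Qed.

Lemma isomorphic_bounded_op V W (f : V -> W) (g : W -> V) :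
  bounded_op f -> bounded_op g -> cancel f g -> cancel g f -> isomorphic V W.
Proof.
have cont (V' W' : normedModType R) (h : {linear V' -> W'}) : bounded_op h -> continuous h.
  move=> /bounded_op_bound[C C0 Ch].
  apply: bounded_linear_continuous; apply/linear_boundedP.
  exists C; split; first exact: num_real.
  by move=> r Cr v; rewrite (le_trans (Ch v))// ler_wpM2r// ltW.
move=> bf bg fg gf; case: (bf) => lf _; case: (bg) => lg _.
pose F : {linear V -> W} := HB.pack f (GRing.isLinear.Build R V W *:%R f lf).
pose G : {linear W -> V} := HB.pack g (GRing.isLinear.Build R W V *:%R g lg).
by exists F, G; split => //; exact: cont.
Qed.

End bounded_operators.

(** * Operators on l1 *)

Section ell1_operators.
Context {R : realType}.

Lemma ell1_sum_le (u : ell1 R) (M : nat) : \sum_(n < M) `|u n| <= `|u|.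
Proof.
have cu : cvgn (series (fun n => `|u n|)) by case: u => u ul; exact/asboolP.
have nd : nondecreasing_seq (series (fun n => `|u n|)).
  by apply/nondecreasing_seqP => k; rewrite /series/= big_nat_recr//= lerDl normr_ge0.
by apply: le_trans (nondecreasing_cvgn_le nd cu M); rewrite seriesEord.
Qed.

Lemma ell1_norm_le (u : ell1 R) (C : R) :
  (forall M, \sum_(n < M) `|u n| <= C) -> `|u| <= C.
Proof.
move=> uC; have cu : cvgn (series (fun n => `|u n|)) by case: u uC => u ul _; exact/asboolP.
apply: limr_le => //; near=> M.
by have := uC M; rewrite -(big_mkord xpredT (fun n => `|u n|)).
Unshelve. all: by end_near. Qed.

Lemma is_ell1_bounded (u : nat -> R) (C : R) :
  (forall M, \sum_(n < M) `|u n| <= C) -> (u : nat -> R^o) \in is_ell1.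
Proof.
move=> uC; apply/asboolP; change (cvgn (series (fun n => `|u n|))).
apply: nondecreasing_is_cvgn.
  by apply/nondecreasing_seqP => k; rewrite /series/= big_nat_recr//= lerDl normr_ge0.
exists C => _ [M _ <-].
by have := uC M; rewrite -(big_mkord xpredT (fun n => `|u n|)).
Qed.

Lemma ell1_coord (u v : ell1 R) (k : R) n : (k *: u + v) n = k * u n + v n.
Proof. by []. Qed.

Lemma ell1P (u v : ell1 R) : (forall n, u n = v n) -> u = v.
Proof. by move=> uv; apply/val_inj/funext => n; exact: uv. Qed.

(** An operator into l1 is given by its coordinate functionals: a uniform bound on
the partial sums provides both membership in l1 and continuity. *)
Lemma ell1_valued_op (W : normedModType R) (F : W -> nat -> R) (C : R) :
  (forall n, linear (fun w => F w n : R^o)) ->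
  (forall w M, \sum_(n < M) `|F w n| <= C * `|w|) ->
  exists2 f : W -> ell1 R, bounded_op f & forall w n, f w n = F w n.
Proof.
move=> lF FC; pose f w := Ell1 (is_ell1_bounded (FC w)).
exists f => //; split; last by exists C => w; apply: ell1_norm_le => M; exact: FC.
by move=> k u v; apply/ell1P => n; rewrite ell1_coord; exact: lF.
Qed.

End ell1_operators.

Section sums.
Context {R : realType}.

Lemma sum_subset_le (T : eqType) (s t : seq T) (F : T -> R) :
  uniq s -> uniq t -> {subset s <= t} -> (forall x, 0 <= F x) ->
  \sum_(x <- s) F x <= \sum_(x <- t) F x.
Proof.
move=> us ut st F0; rewrite [leRHS](bigID (mem s))/=.
rewrite -[X in _ <= X + _]big_filter (@perm_big _ _ _ _ s [seq x <- t | x \in s]).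
  by rewrite lerDl sumr_ge0.
apply: uniq_perm; rewrite ?filter_uniq// => x; rewrite mem_filter/=.
by have [/st ->|] := boolP (x \in s).
Qed.

Lemma nat_pairing : exists (pr : nat * nat -> nat) (un : nat -> nat * nat),
  cancel pr un /\ cancel un pr.
Proof.
have /card_set_bijP[f] := card_nat2; rewrite setTT_bijective => -[g fg gf].
by exists f, g.
Qed.

Lemma seq_ub (T : eqType) (s : seq T) (h : T -> nat) :
  exists K, forall x, x \in s -> (h x < K)%N.
Proof.
exists (\max_(x <- s) h x).+1 => x xs.
by rewrite ltnS; apply: (@leq_bigmax_seq _ _ xpredT h).  
Qed.

Lemma ell1_reindex_le (x : ell1 R) (M : nat) (Q : pred nat) (h : nat -> nat) :
  {in Q &, injective h} -> \sum_(n < M | Q n) `|x (h n)| <= `|x|.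
Proof.
move=> hinj; rewrite -(big_mkord Q (fun n => `|x (h n)|)) -big_filter.
set s := seq.filter _ _; rewrite -(big_map h xpredT (fun n => `|x n|)).
have [K hK] := seq_ub (map h s) id.
apply: le_trans (ell1_sum_le x K).
rewrite -(big_mkord xpredT (fun n => `|x n|)).
apply: sum_subset_le => //.
- rewrite map_inj_in_uniq ?filter_uniq ?iota_uniq// => i j.
  by rewrite !mem_filter => /andP[Qi _] /andP[Qj _]; exact: hinj.
- exact: iota_uniq.
- by move=> i /hK/=; rewrite mem_index_iota.
Qed.

Lemma ell1_sum_cvg (x : ell1 R) : (fun N => \sum_(i < N) `|x i|) @ \oo --> `|x|.
Proof.
have cx : cvgn (series (fun n => `|x n|)) by case: x => u ul; exact/asboolP.
rewrite (_ : (fun N => _) = series (fun n => `|x n|)); first exact: cx.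
by apply/funext => N; rewrite /series/= big_mkord.
Qed.

(** The norms of K vectors can be summed by truncating all of them at the same
length N, because the sum over k is finite and commutes with the limit in N. *)
Lemma ell1_rows_le (r : nat -> ell1 R) (C : R) (K : nat) :
  (forall N, \sum_(k < K) \sum_(i < N) `|r k i| <= C) ->
  \sum_(k < K) `|r k| <= C.
Proof.
move=> rC; suff cv : (fun N => \sum_(k < K) \sum_(i < N) `|r k i|) @ \oo --> \sum_(k < K) `|r k|.
  apply: (cvgr_to_le cv).
  by apply: nearW.
elim: K {rC} => [|K IH].
  rewrite big_ord0 (_ : (fun N => _) = cst 0); first exact: cvg_cst.
  by apply/funext => N; rewrite big_ord0.
rewrite big_ord_recr/=.
rewrite (_ : (fun N => _) = (fun N => \sum_(k < K) \sum_(i < N) `|r k i| + \sum_(i < N) `|r K i|)).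
  by apply: cvgD => //; exact: ell1_sum_cvg.
by apply/funext => N; rewrite big_ord_recr.
Qed.

End sums.

(** * Pelczynski's decomposition method *)

Section decomposition.
Context {R : realType}.
Local Notation ell1 := (ell1 R).

Section reindexing.
Context (Q : pred nat) (h : nat -> nat) (hinj : {in Q &, injective h}).

Let coord (x : ell1) n : R := if Q n then x (h n) else 0.

Let coord_bound x M : \sum_(n < M) `|coord x n| <= `|x|.
Proof.
apply: le_trans (ell1_reindex_le x M hinj); rewrite [leRHS]big_mkcond/=.
by apply: ler_sum => n _; rewrite /coord; case: (Q n); rewrite ?normr0.
Qed.

(** The common form of all the reindexing operators below: since h is injective
where it is used, no coordinate is counted twice and the norm does not grow. *)
Definition reindexed (x : ell1) : ell1 := Ell1 (is_ell1_bounded (coord_bound x)).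

Lemma reindexedE x n : reindexed x n = if Q n then x (h n) else 0.
Proof. by []. Qed.

Lemma reindexed_op : bounded_op reindexed.
Proof.
split; last by exists 1 => x; rewrite mul1r; apply: ell1_norm_le; exact: coord_bound.
move=> k u v; apply/ell1P => n; rewrite !(ell1_coord, reindexedE).
by case: (Q n); rewrite ?mulr0 ?addr0.
Qed.

End reindexing.

(** Through a pairing of nat with nat * nat, an element of l1 is an infinite matrix
whose rows are elements of l1; this is the identification of l1 with l1(l1).
[row_drop] deletes row 0, [row_shift] inserts a zero row in front, and [row0_inv]
builds the matrix with a given row 0 and zeros elsewhere. *)
Context (pr : nat * nat -> nat) (un : nat -> nat * nat).
Context (prK : cancel pr un) (unK : cancel un pr).

Let row_inj k : {in xpredT &, injective (fun n => pr (k, n))}.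
Proof. by move=> i j _ _ /(can_inj prK)[]. Qed.

Definition row k : ell1 -> ell1 := reindexed (@row_inj k).

Let row0_inj : {in (fun n => (un n).1 == 0%N) &, injective (fun n => (un n).2)}.
Proof.
move=> i j /eqP i1 /eqP j1 ij.
by rewrite -[i]unK -[j]unK [un i]surjective_pairing [un j]surjective_pairing i1 j1 ij.
Qed.

Definition row0_inv : ell1 -> ell1 := reindexed (@row0_inj).

Let up_inj : {in xpredT &, injective (fun n => pr ((un n).1.+1, (un n).2))}.
Proof.
move=> i j _ _ /(can_inj prK)[i1 j1].
by rewrite -[i]unK -[j]unK [un i]surjective_pairing [un j]surjective_pairing i1 j1.
Qed.

Definition row_drop : ell1 -> ell1 := reindexed (@up_inj).

Let down_inj : {in (fun n => (0 < (un n).1)%N) &, injective (fun n => pr ((un n).1.-1, (un n).2))}.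
Proof.
move=> i j; rewrite !unfold_in => i0 j0 /(can_inj prK)[i1 j1].
have {}i1 : (un i).1 = (un j).1 by rewrite -(prednK i0) i1 prednK.
by rewrite -[i]unK -[j]unK [un i]surjective_pairing [un j]surjective_pairing i1 j1.
Qed.

Definition row_shift : ell1 -> ell1 := reindexed (@down_inj).

Lemma row_op k : bounded_op (row k). Proof. exact: reindexed_op. Qed.

Lemma row0_row0_inv x : row 0 (row0_inv x) = x.
Proof. by apply/ell1P => n; rewrite !reindexedE prK/=. Qed.

Lemma row0_shift x : row 0 (row_shift x) = 0.
Proof. by apply/ell1P => n; rewrite !reindexedE prK/=. Qed.

Lemma drop_shift x : row_drop (row_shift x) = x.
Proof. by apply/ell1P => n; rewrite !reindexedE !prK/= -surjective_pairing unK. Qed.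

Lemma drop_row0_inv x : row_drop (row0_inv x) = 0.
Proof. by apply/ell1P => n; rewrite !reindexedE !prK/=. Qed.

Lemma row0_inv_shift x : row0_inv (row 0 x) + row_shift (row_drop x) = x.
Proof.
apply/ell1P => n; rewrite -[X in X + _]scale1r ell1_coord mul1r !reindexedE/= !prK/=.
rewrite -[in RHS](unK n); case: (un n) => [[|k] i]/=; first by rewrite addr0.
by rewrite add0r.
Qed.

Section amplification.
Context (P : ell1 -> ell1) (bP : bounded_op P).

Let coord (x : ell1) n : R := P (row (un n).1 x) (un n).2.

Let amp_bound : exists C : R, forall x M, \sum_(n < M) `|coord x n| <= C * `|x|.
Proof.
have [C C0 PC] := bounded_op_bound bP; exists C => x M.
have [K hK] := seq_ub (map un (iota 0 M)) fst.
have [N hN] := seq_ub (map un (iota 0 M)) snd.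
apply: (@le_trans _ _ (\sum_(k < K) \sum_(i < N) `|P (row k x) i|)).
  pose F (t : nat * nat) := `|P (row t.1 x) t.2|.
  rewrite -(big_mkord xpredT (fun n => F (un n))) /index_iota subn0.
  rewrite -(big_map un xpredT F)
    (eq_bigr _ (fun k _ => esym (big_mkord xpredT (fun i => F (nat_of_ord k, i))))).
  rewrite -(big_mkord xpredT (fun k => \sum_(0 <= i < N) F (k, i))) -big_allpairs.
  apply: sum_subset_le => [| |[k i] ki|t].
  - rewrite map_inj_uniq ?iota_uniq//. exact: can_inj unK.
  - by apply: allpairs_uniq; rewrite ?iota_uniq// => -[? ?] [? ?] _ _ [-> ->].
  - apply/allpairsP; exists (k, i); split => //=; rewrite mem_index_iota.
      exact: (hK (k, i)).
    exact: (hN (k, i)).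
  - exact: normr_ge0.
apply: (@le_trans _ _ (\sum_(k < K) C * `|row k x|)).
  by apply: ler_sum => k _; rewrite (le_trans (ell1_sum_le _ _)).
rewrite -mulr_sumr ler_wpM2l//; apply: (ell1_rows_le (r := fun k => row k x)) => N'.
pose F n := `|x n|.
under eq_bigr => k _ do rewrite -(big_mkord xpredT (fun i => F (pr (nat_of_ord k, i)))).
rewrite -(big_mkord xpredT (fun k => \sum_(0 <= i < N') F (pr (k, i)))).
rewrite -(@big_allpairs _ _ _ _ _ _ _ (fun t => F (pr t))) -(big_map pr xpredT F).
set s := map _ _.
have [L hL] := seq_ub s id.
apply: le_trans (ell1_sum_le x L); rewrite -(big_mkord xpredT F).
apply: sum_subset_le => [| |i /hL|t].
- rewrite map_inj_uniq; last exact: can_inj prK.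
  by apply: allpairs_uniq; rewrite ?iota_uniq// => -[? ?] [? ?] _ _ [-> ->].
- exact: iota_uniq.
- by rewrite mem_index_iota.
- exact: normr_ge0.
Qed.

(** Applying P to every row is bounded on l1(l1) with the bound of P, as the norm
of a matrix is the sum of the norms of its rows. *)
Lemma amplification : exists2 Pinf : ell1 -> ell1, bounded_op Pinf &
  (forall x k, row k (Pinf x) = P (row k x)).
Proof.
have [C hC] := amp_bound.
have [|Pinf bPinf PinfE] := @ell1_valued_op R ell1 coord C _ hC.
  by move=> n k u v; rewrite /coord (row_op _).1 bP.1.
exists Pinf => // x k; apply/ell1P => n.
by rewrite reindexedE PinfE /coord prK.
Qed.

End amplification.

Lemma rowsP x y : (forall k, row k x = row k y) -> x = y.
Proof.
move=> xy; apply/ell1P => n.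
have := congr1 (fun z : ell1 => z (un n).2) (xy (un n).1).
by rewrite !reindexedE -surjective_pairing unK.
Qed.

Lemma row_dropE x k : row k (row_drop x) = row k.+1 x.
Proof. by apply/ell1P => n; rewrite !reindexedE prK. Qed.

Lemma row_shiftE x k : row k.+1 (row_shift x) = row k x.
Proof. by apply/ell1P => n; rewrite !reindexedE prK. Qed.

End decomposition.

Section pelczynski.
Context {R : realType} (V : normedModType R).
Local Notation ell1 := (ell1 R).

(** Write W for the range of 1 - S T, so that l1 is V + W, and V' for the range of
1 - A B, so that V is V' + l1. Then
    l1 = (V + W) + (V + W) + ... = V + (W + V) + (W + V) + ... = V + l1,
    V = V' + l1 = V' + l1 + l1 = V + l1.
The maps F and G of the proof compose these identifications: the first regrouping
acts on rows of l1(l1), and l1 = l1 + l1 splits off row 0. *)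
Theorem pelczynski_ell1 (S : V -> ell1) (T : ell1 -> V) (A : ell1 -> V) (B : V -> ell1) :
  bounded_op S -> bounded_op T -> bounded_op A -> bounded_op B ->
  cancel S T -> cancel A B -> isomorphic V ell1.
Proof.
move=> bS bT bA bB ST AB.
have [pr [un [prK unK]]] := nat_pairing.
have [Pinf bP PE] := amplification prK unK (bounded_op_comp bS bT).
pose rw := row (R := R) prK; pose i0 := row0_inv (R := R) unK; pose D := row_drop (R := R) prK unK.
pose L := row_shift (R := R) prK unK.
have br k : bounded_op (rw k) by exact: row_op.
have bi : bounded_op i0 by exact: reindexed_op.
have bD : bounded_op D by exact: reindexed_op.
have bL : bounded_op L by exact: reindexed_op.
have rowP x y : (forall k, rw k x = rw k y) -> x = y by exact: rowsP.
have rE k x : rw k (Pinf x) = S (T (rw k x)) by exact: PE.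
have rD k x : rw k (D x) = rw k.+1 x by exact: row_dropE.
have r0L x : rw 0%N (L x) = 0 by exact: row0_shift.
have rL k x : rw k.+1 (L x) = rw k x by exact: row_shiftE.
have r0i x : rw 0%N (i0 x) = x by exact: row0_row0_inv.
have DL x : D (L x) = x by exact: drop_shift.
have Di x : D (i0 x) = 0 by exact: drop_row0_inv.
have iL x : i0 (rw 0%N x) + L (D x) = x by exact: row0_inv_shift.
have op0 (U W : normedModType R) (f : U -> W) : bounded_op f -> f 0 = 0.
  by move=> bf; rewrite -(subrr 0) (bounded_opB1 bf) subrr.
have ri k x : rw k.+1 (i0 x) = 0 by rewrite -rD Di op0.
pose Q w := S (T w).
have bQ : bounded_op Q by exact: bounded_op_comp.
have QQ w : Q (Q w) = Q w by rewrite /Q ST.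
have QS v : Q (S v) = S v by rewrite /Q ST.
(* red v and the rows below row 0 of B v are the two components of v under
   V = V + l1: the row 0 of B v takes over the place of B v. *)
pose red v := v - A (B v) + A (rw 0%N (B v)).
(* With Q = S T: row 0 of F v is S (red v) + (1 - Q) z_0 and row k+1 is
   Q z_k + (1 - Q) z_(k+1), where z_k are the rows of D (B v). *)
pose F v := i0 (S (red v)) + L (Pinf (D (B v))) + (D (B v) - Pinf (D (B v))).
(* tail undoes the regrouping: its row k is (1 - Q) x_k + Q x_(k+1). *)
pose tail x := x - Pinf x + D (Pinf x).
pose G x := T (rw 0%N x) - A (B (T (rw 0%N x))) + A (i0 (B (T (rw 0%N x))) + L (tail x)).
have Bred v : B (red v) = rw 0%N (B v).
  by rewrite (bounded_opD1 bB) (bounded_opB1 bB) !AB subrr add0r.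
have F0 v : rw 0%N (F v) = S (red v) + (rw 0%N (D (B v)) - Q (rw 0%N (D (B v)))).
  by rewrite (bounded_opD1 (br 0%N)) (bounded_opB1 (br 0%N)) (bounded_opD1 (br 0%N)) r0i r0L addr0 rE.
have FS v k : rw k.+1 (F v) =
    Q (rw k (D (B v))) + (rw k.+1 (D (B v)) - Q (rw k.+1 (D (B v)))).
  by rewrite (bounded_opD1 (br k.+1)) (bounded_opB1 (br k.+1)) (bounded_opD1 (br k.+1)) ri add0r rL !rE.
have TF v : T (rw 0%N (F v)) = red v.
  by rewrite F0 (bounded_opD1 bT) (bounded_opB1 bT) /Q !ST subrr addr0.
have tailF v : tail (F v) = D (B v).
  apply: rowP => k; rewrite (bounded_opD1 (br k)) (bounded_opB1 (br k)) rD !rE.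
  rewrite -/(Q _) -/(Q _) FS; case: k => [|k].
    rewrite F0 (bounded_opD1 bQ) (bounded_opB1 bQ) (bounded_opD1 bQ) (bounded_opB1 bQ)
      !QQ QS !subrr !addr0.
    by rewrite (addrC (S _)) addrK subrK.
  rewrite FS (bounded_opD1 bQ) (bounded_opB1 bQ) (bounded_opD1 bQ) (bounded_opB1 bQ)
    !QQ !subrr !addr0.
  by rewrite (addrC (Q (rw k _))) addrK subrK.
apply: (@isomorphic_bounded_op _ _ _ F G).
- have bBB := bounded_op_comp bD bB.
  apply: bounded_opD; last by apply: bounded_opB => //; exact: bounded_op_comp.
  apply: bounded_opD; last by do 2 apply: bounded_op_comp => //.
  apply: bounded_op_comp => //; apply: bounded_op_comp => //.
  apply: bounded_opD; first by apply: bounded_opB; [exact: bounded_op_id|exact: bounded_op_comp].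
  by do 2 apply: bounded_op_comp => //.
- have b1 := bounded_op_comp bT (br 0%N); have b2 := bounded_op_comp bB b1.
  apply: bounded_opD; first by apply: bounded_opB => //; exact: bounded_op_comp.
  apply: bounded_op_comp => //; apply: bounded_opD; first exact: bounded_op_comp.
  apply: bounded_op_comp => //; apply: bounded_opD; last exact: bounded_op_comp.
  by apply: bounded_opB => //; exact: bounded_op_id.
- by move=> v; rewrite /G TF tailF Bred iL /red addrK subrK.
- move=> x; have BG : B (G x) = i0 (B (T (rw 0%N x))) + L (tail x).
    by rewrite (bounded_opD1 bB) (bounded_opB1 bB) !AB subrr add0r.
  have redG : red (G x) = T (rw 0%N x).
    by rewrite /red BG (bounded_opD1 (br 0%N)) r0i r0L addr0 /G addrK subrK.
  have DG : D (B (G x)) = tail x by rewrite BG (bounded_opD1 bD) Di DL add0r.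
  have Qtail k : Q (rw k (tail x)) = Q (rw k.+1 x).
    rewrite (bounded_opD1 (br k)) (bounded_opB1 (br k)) rD !rE -!/(Q _).
    by rewrite (bounded_opD1 bQ) (bounded_opB1 bQ) !QQ subrr add0r.
  have Ptail k : rw k (tail x) - Q (rw k (tail x)) = rw k x - Q (rw k x).
    rewrite Qtail (bounded_opD1 (br k)) (bounded_opB1 (br k)) rD !rE -!/(Q _).
    by rewrite addrK.
  apply: rowP => -[|k].
    by rewrite F0 redG DG Ptail /Q addrCA subrr addr0.
  by rewrite FS DG Ptail Qtail addrCA subrr addr0.
Qed.
End pelczynski.

(** * The Lipschitz free space *)

Section free_space_theory.
Context {R : realType} {Z : metricType R} (z0 : Z).
Local Notation LF := (free_space z0).
Local Notation LipZ := (lip0 z0).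

Lemma lip0_norm_le (f : LipZ) (C : R) : 0 <= C ->
  (forall x y, `|f x - f y| <= C * mdist x y) -> `|f| <= C.
Proof. by move=> C0 fC; apply: least_const_le; split => // -[x y]; exact: fC. Qed.

Lemma lip0_normP (f : LipZ) x y : `|f x - f y| <= `|f| * mdist x y.
Proof. exact: lip_constP. Qed.

Lemma is_dual_bounded (phi : LipZ -> R) (C : R) : linear (phi : LipZ -> R^o) ->
  (forall f, `|phi f| <= C * `|f|) -> (phi : LipZ -> R^o) \in @is_dual R LipZ.
Proof.
move=> lphi phiC; apply/asboolP; split => //.
pose F : {linear LipZ -> R^o} := HB.pack (phi : LipZ -> R^o)
  (GRing.isLinear.Build R LipZ R^o *:%R _ lphi).
apply: (@bounded_linear_continuous R LipZ R^o F); apply/linear_boundedP.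
exists C; split; first exact: num_real.
by move=> r Cr v; rewrite (le_trans (phiC v))// ler_wpM2r// ltW.
Qed.

Lemma dual_linear (phi : dual_space LipZ) : linear phi.
Proof. by case: phi => phi h; case/asboolP: (h). Qed.

Lemma dual_apply_le (phi : dual_space LipZ) f : `|phi f| <= `|phi| * `|f|.
Proof.
case: phi => phi h; case/asboolP: (h) => lphi cphi.
pose F : {linear LipZ -> R^o} := HB.pack (phi : LipZ -> R^o)
  (GRing.isLinear.Build R LipZ R^o *:%R _ lphi).
have /linear_boundedP/pinfty_ex_gt0[M M0 FM] : bounded_near F (nbhs (0 : LipZ)).
  by apply: continuous_linear_bounded; exact: cphi.
apply: (@least_constP _ _ (fun f : LipZ => `|phi f|) (fun f : LipZ => `|f|)) => //.
by exists M; split; [exact: ltW|exact: FM].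
Qed.

Lemma dual_norm_le (phi : dual_space LipZ) (C : R) : 0 <= C ->
  (forall f, `|phi f| <= C * `|f|) -> `|phi| <= C.
Proof. by move=> C0 phiC; exact: least_const_le. Qed.

Lemma free_apply_le (phi : LF) f : `|phi f| <= `|phi| * `|f|.
Proof. exact: dual_apply_le. Qed.

Lemma free_norm_le (phi : LF) (C : R) : 0 <= C ->
  (forall f, `|phi f| <= C * `|f|) -> `|phi| <= C.
Proof. exact: dual_norm_le. Qed.

Lemma free_linear (phi : LF) : linear phi.
Proof. exact: dual_linear. Qed.

Lemma freeP (phi psi : LF) : (forall f, phi f = psi f) -> phi = psi.
Proof. by move=> pq; apply/val_inj/val_inj/funext => f; exact: pq. Qed.

Lemma free_addE (phi psi : LF) f : (phi + psi) f = phi f + psi f.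
Proof. by []. Qed.

Lemma free_sum (M : nat) (c : 'I_M -> R) (v : 'I_M -> LF) f :
  (\sum_(i < M) c i *: v i) f = \sum_(i < M) c i * v i f.
Proof.
elim: M c v => [|M IH] c v; first by rewrite !big_ord0.
by rewrite !big_ord_recr free_addE IH.
Qed.

Lemma closure_norm (V : normedModType R) (A : set V) (v : V) :
  closure A v <-> forall e : R, 0 < e -> exists2 w, A w & `|v - w| < e.
Proof.
split => [Av e e0|Av B /nbhs_ballP[e /= e0 eB]].
  by have [w [Aw]] := Av _ (nbhsx_ballx v e e0); rewrite -ball_normE; exists w.
by have [w Aw vw] := Av _ e0; exists w; split => //; apply: eB; rewrite -ball_normE.
Qed.

(** The free space is defined as a closure, so it contains the norm limits of its
own elements. *)
Lemma is_free_closed (phi : dual_space LipZ) :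
  (forall e : R, 0 < e -> exists psi : LF, `|phi - free_fun psi| < e) ->
  phi \in @is_free R Z z0.
Proof.
move=> app; apply/asboolP/closure_norm => e e0.
have [psi ppsi] := app _ (divr_gt0 e0 (ltr0n R 2)).
case: psi ppsi => psi /= /[dup] + /asboolP/closure_norm.
move=> _ /(_ _ (divr_gt0 e0 (ltr0n R 2)))[chi Achi pchi] ppsi.
exists chi => //; rewrite -(subrK psi phi) -addrA (le_lt_trans (ler_normD _ _))//.
by rewrite [e]splitr ltrD.
Qed.

Let delta_free x : delta z0 x \in @is_free R Z z0.
Proof.
apply/asboolP/subset_closure; exists 1%N, (fun=> 1), (fun=> delta z0 x); split.
  by move=> _; exists x.
by rewrite big_ord1 scale1r.
Qed.

Definition free_delta x : LF := FreeSpace (delta_free x).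

Lemma free_deltaE x f : free_delta x f = f x. Proof. by []. Qed.

(** Bounded operators that agree on the point evaluations agree on their span and,
by density, on the whole free space. *)
Lemma free_op_ext (W : normedModType R) (F G : LF -> W) :
  bounded_op F -> bounded_op G -> (forall x, F (free_delta x) = G (free_delta x)) ->
  F =1 G.
Proof.
move=> bF bG FG phi; apply/eqP; rewrite -subr_eq0 -normr_le0.
have [C C0 HC] := bounded_op_bound (bounded_opB bF bG).
apply/ler_addgt0Pr => e e0; rewrite add0r.
case: phi => phi hphi; have /asboolP/closure_norm app := hphi.
have C1 : 0 < C + 1 by rewrite ltr_wpDl.
have [psi [n [c [u [Au psiE]]]] ppsi] := app _ (divr_gt0 e0 C1).
pose p : LF := FreeSpace hphi.
have /choice[x xE] : forall i, exists x, delta z0 x = u i.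
  by move=> i; have [x _ xu] := Au i; exists x.
pose q : LF := \sum_(i < n) c i *: free_delta (x i).
have qE : free_fun q = psi.
  rewrite psiE /q; have sumE (m : nat) (cc : 'I_m -> R) (xx : 'I_m -> Z) :
      free_fun (\sum_(i < m) cc i *: free_delta (xx i)) = \sum_(i < m) cc i *: delta z0 (xx i).
    by rewrite (big_morph (@free_fun R Z z0) (id1 := 0) (op1 := +%R)).
  by rewrite sumE; apply: eq_bigr => i _; rewrite xE.
have FGq : F q - G q = 0.
  rewrite /q; elim: (n) (c) (x) => [|m IH] cc xx.
    by rewrite big_ord0 -(subrr 0) (bounded_opB1 bF) (bounded_opB1 bG) !subrr.
  rewrite big_ord_recr (bounded_opD1 bF) (bounded_opD1 bG) opprD addrACA IH add0r.
  by rewrite (bounded_opZ1 bF) (bounded_opZ1 bG) FG subrr.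
have -> : F p - G p = F (p - q) - G (p - q).
  by rewrite (bounded_opB1 bF) (bounded_opB1 bG) (subr0_eq FGq) opprB addrA subrK.
rewrite (le_trans (HC _))//.
have pq : `|p - q| < e / (C + 1) by rewrite free_normE /= qE.
rewrite (le_trans (ler_wpM2l C0 (ltW pq)))// mulrCA ger_pMr// ler_pdivrMr// mul1r.
by rewrite lerDl.
Qed.

End free_space_theory.

(** * Operators between the free space and l1 *)

Section frames.
Context {R : realType} {Z : metricType R} (z0 : Z).
Local Notation LF := (free_space z0).
Local Notation LipZ := (lip0 z0).

Lemma lip0_sum (M : nat) (c : 'I_M -> R) (g : 'I_M -> LipZ) x :
  (\sum_(i < M) c i *: g i) x = \sum_(i < M) c i * g i x.
Proof.
have addE (f h : LipZ) : (f + h) x = f x + h x by [].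
elim: M c g => [|M IH] c g; first by rewrite !big_ord0.
by rewrite !big_ord_recr addE IH.
Qed.

Lemma free_apply_sum (phi : LF) (M : nat) (c : 'I_M -> R) (g : 'I_M -> LipZ) :
  phi (\sum_(i < M) c i *: g i) = \sum_(i < M) c i * phi (g i).
Proof.
have phiD f h : phi (f + h) = phi f + phi h.
  by have := free_linear phi 1 f h; rewrite !scale1r.
have phi0 : phi 0 = 0.
  by have := phiD 0 0; rewrite addr0 => /esym/eqP; rewrite -subr_eq0 addrK => /eqP.
have phiZ k f : phi (k *: f) = k * phi f.
  by have := free_linear phi k f 0; rewrite phi0 !addr0.
elim: M c g => [|M IH] c g; first by rewrite !big_ord0.
by rewrite !big_ord_recr phiD IH phiZ.
Qed.

(** If (g n) are the coordinates of a Lipschitz map to l1, then the pairing with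
the g n is a bounded operator from the free space to l1: by duality,
sum |phi (g n)| = phi (sum +-(g n)), and each signed sum is C-Lipschitz. It avoids
any extension of operators from the span of the evaluations to its closure. *)
Lemma analysis_op (g : nat -> LipZ) (C : R) :
  (forall M x y, \sum_(n < M) `|g n x - g n y| <= C * mdist x y) ->
  exists2 S : LF -> ell1 R, bounded_op S & forall phi n, S phi n = phi (g n).
Proof.
move=> gC; apply: (@ell1_valued_op R LF (fun phi n => phi (g n)) `|C|) => // phi M.
pose c (n : 'I_M) := Num.sg (phi (g n)).
have -> : \sum_(n < M) `|phi (g n)| = phi (\sum_(n < M) c n *: g n).
  by rewrite free_apply_sum; apply: eq_bigr => n _; rewrite normrEsg.
rewrite (le_trans (ler_norm _))// (le_trans (free_apply_le _ _))// mulrC ler_wpM2r//.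
apply: lip0_norm_le => // x y; rewrite !lip0_sum -sumrB.
rewrite (le_trans (ler_norm_sum _ _ _))//.
apply: le_trans (_ : C * mdist x y <= _); last first.
  by rewrite ler_wpM2r ?mdist_ge0// ler_norm.
apply: le_trans (gC M x y); apply: ler_sum => n _.
rewrite -mulrBr normrM ler_piMl//.
by rewrite /c normr_sg; case: eqP.
Qed.

(** The operator sending the n-th unit vector of l1 to v n. The sum of the x n v n
is first defined as a functional, by a numerical series for each f, and then shown
to be a norm limit of its partial sums, which lie in the free space. *)
Lemma synthesis_op (v : nat -> LF) (C : R) : 0 <= C -> (forall n, `|v n| <= C) ->
  exists2 T : ell1 R -> LF, bounded_op T &
    forall (x : ell1 R) (f : LipZ), (fun M => \sum_(n < M) x n * v n f) @ \oo --> T x f.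
Proof.
move=> C0 vC.
have term (x : ell1 R) f n : `|x n * v n f| <= C * `|f| * `|x n|.
  rewrite normrM mulrC ler_wpM2r// (le_trans (free_apply_le _ _))//.
  by rewrite ler_wpM2r.
have cv (x : ell1 R) f : cvgn (series (fun n => x n * v n f)).
  apply: normed_cvg.
  have cx : cvgn (series (fun n => `|x n|)) by case: (x) => u ul; exact/asboolP.
  apply: (@series_le_cvg _ _ (C * `|f| *: (fun n => `|x n| : R^o))) => [n|n|n|].
  - exact: normr_ge0.
  - by rewrite !mulr_ge0.
  - exact: term.
  - exact: is_cvg_seriesZ.
have seriesE (x : ell1 R) f M : series (fun n => x n * v n f) M = \sum_(n < M) x n * v n f.
  by rewrite /series/= big_mkord.
pose F (x : ell1 R) f : R := limn (series (fun n => x n * v n f)).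
have cvF (x : ell1 R) f : (fun M => \sum_(n < M) x n * v n f) @ \oo --> F x f.
  by under eq_fun => M do rewrite -seriesE; exact: cv.
(* Uniformity in f makes the partial sums converge in the dual norm. *)
have tail (x : ell1 R) f M : `|F x f - \sum_(n < M) x n * v n f| <=
    C * `|f| * (`|x| - \sum_(n < M) `|x n|).
  have cvD : (fun N => `|\sum_(n < N) x n * v n f - \sum_(n < M) x n * v n f|) @ \oo -->
      `|F x f - \sum_(n < M) x n * v n f|.
    by apply: cvg_norm; apply: cvgB => //; exact: cvg_cst.
  apply: (cvgr_to_le cvD); near=> N.
  have MN : (M <= N)%N by near: N; exact: nbhs_infty_ge.
  apply: le_trans (_ : C * `|f| * (\sum_(n < N) `|x n| - \sum_(n < M) `|x n|) <= _); last first.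
    by rewrite ler_wpM2l ?mulr_ge0// lerB// ell1_sum_le.
  rewrite -!(big_mkord xpredT (fun n => x n * v n f)) -!(big_mkord xpredT (fun n => `|x n|)).
  rewrite !(big_cat_nat (leq0n M) MN)/= !(addrC (\sum_(0 <= i < M) _)) !addrK mulr_sumr.
  by rewrite (le_trans (ler_norm_sum _ _ _))// ler_sum.
have cvD (u w : nat -> R) (k a b : R) : u @ \oo --> a -> w @ \oo --> b ->
    (fun n => k * u n + w n) @ \oo --> k * a + b.
  by move=> ua wb; apply: cvgD => //; apply: cvgM => //; exact: cvg_cst.
have lin2 x k f g : F x (k *: f + g) = k * F x f + F x g.
  apply: (cvg_unique _ (cvF x (k *: f + g))) => //.
  rewrite (_ : (fun M => _) = (fun M => k * (\sum_(n < M) x n * v n f) + \sum_(n < M) x n * v n g)).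
    exact: cvD.
  apply/funext => M; rewrite mulr_sumr -big_split/=; apply: eq_bigr => n _.
  by rewrite (free_linear (v n) k f g) mulrDr mulrCA.
have lin1 x y k f : F (k *: x + y) f = k * F x f + F y f.
  apply: (cvg_unique _ (cvF (k *: x + y) f)) => //.
  rewrite (_ : (fun M => _) = (fun M => k * (\sum_(n < M) x n * v n f) + \sum_(n < M) y n * v n f)).
    exact: cvD.
  apply/funext => M; rewrite mulr_sumr -big_split/=; apply: eq_bigr => n _.
  by transitivity ((k * x n + y n) * v n f); [|rewrite mulrDl mulrA].
have linF x : linear (F x : LipZ -> R^o) by move=> k f g; exact: lin2.
have bF x f : `|F x f| <= C * `|x| * `|f|.
  by have := tail x f 0%N; rewrite !big_ord0 !subr0 mulrAC.
have app x : (Dual (is_dual_bounded (linF x) (bF x))) \in @is_free R Z z0.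
  apply: is_free_closed => e e0.
  have C1 : 0 < C + 1 by rewrite ltr_wpDl.
  have /cvgrPdist_lt/(_ _ (divr_gt0 e0 C1)) := @ell1_sum_cvg R x.
  move=> [M _ /(_ M (leqnn M)) HM].
  exists (\sum_(n < M) x n *: v n).
  apply: (@le_lt_trans _ _ (C * (e / (C + 1)))); last first.
    by rewrite mulrCA gtr_pMr// ltr_pdivrMr ?mul1r ?ltrDl// ltr_wpDl.
  apply: dual_norm_le => [|f]; first by rewrite mulr_ge0// divr_ge0 ?addr_ge0 ?(ltW e0).
  have -> : (Dual (is_dual_bounded (linF x) (bF x)) - free_fun (\sum_(n < M) x n *: v n)) f =
    F x f - \sum_(n < M) x n * v n f by rewrite -free_sum.
  rewrite (le_trans (tail _ _ _))// mulrAC ler_wpM2r// ler_wpM2l//.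
  by rewrite (le_trans (ler_norm _))// ltW.
exists (fun x => FreeSpace (app x)) => [|x f]; last exact: cvF.
split; last first.
  by exists C => x; apply: free_norm_le => [|f]; [exact: mulr_ge0|exact: bF].
move=> k x y; apply: freeP => f; exact: lin1.
Unshelve. all: by end_near.
Qed.

End frames.

(** * A complemented copy of l1 in the free space *)

Section complemented_ell1.
Context {R : realType} {Z : metricType R} (z0 : Z).
Local Notation LF := (free_space z0).
Local Notation LipZ := (lip0 z0).

Lemma sum_at_most_one (M : nat) (a : 'I_M -> R) :
  (forall i j, a i != 0 -> a j != 0 -> i = j) ->
  \sum_(i < M) ((a i != 0)%:R : R) <= 1.
Proof.
move=> a1; have [/existsP[i ai]|/existsPn a0] := boolP [exists i, a i != 0].
  rewrite (bigD1 i)//= ai big1 ?addr0// => j ji.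
  by case: (boolP (a j != 0)) => // /a1/(_ ai) /eqP; rewrite (negbTE ji).
by rewrite big1 ?ler01// => i _; rewrite (negbTE (a0 i)).
Qed.

Lemma is_lip0_sub (f : Z -> R) (C : R) :
  (forall x y, `|f x - f y| <= C * mdist x y) ->
  (fun x => f x - f z0 : R^o) \in @is_lip0 R Z z0.
Proof.
move=> fC; apply/asboolP; split; first by rewrite subrr.
by exists C => x y; rewrite opprB addrA subrK.
Qed.

(** The bumps h n are supported in disjoint balls around q n which avoid p. At most
one of them is nonzero at any given point, so their signed sums are 2-Lipschitz, and
they are biorthogonal to the normalized differences v n of the evaluations at q n
and p. *)
Lemma ell1_complemented (p : Z) (q : nat -> Z) :
  (forall n, 0 < mdist (q n) p) ->
  (forall n, mdist (q n.+1) p <= mdist (q n) p / 4) ->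
  exists (A : ell1 R -> LF) (B : LF -> ell1 R),
    [/\ bounded_op A, bounded_op B & cancel A B].
Proof.
move=> q0 q4; pose r n := mdist (q n) p / 2.
have r0 n : 0 < r n by rewrite divr_gt0.
have q4lt m n : (m < n)%N -> mdist (q n) p <= mdist (q m) p / 4.
  elim: n => // n IH; rewrite ltnS leq_eqVlt => /orP[/eqP <-//|/IH mn].
  by have := q4 n; have := q0 n; have := q0 m; lra.
pose h n x : R := Num.max 0 (r n - mdist x (q n)).
have h0 n x : h n x != 0 -> mdist x (q n) < r n.
  by rewrite /h; case: (ltP 0 (r n - _)); [rewrite subr_gt0|rewrite eqxx].
have hlip n x y : `|h n x - h n y| <= mdist x y.
  have t1 := metric_triangle x y (q n); have t2 := metric_triangle y x (q n).
  have := mdist_ge0 x y; rewrite (metric_sym y x) in t2.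
  by rewrite /h ler_norml; case: (ltP 0 (r n - mdist x _)); case: (ltP 0 (r n - mdist y _)); lra.
have disj_lt m n x : (m < n)%N -> h m x != 0 -> h n x != 0 -> False.
  move=> mn /h0 xm /h0 xn; have := q4lt _ _ mn; have := q0 n; have := q0 m.
  have := metric_triangle (q m) x p; have := metric_triangle x (q n) p.
  by rewrite (metric_sym (q m) x); move: xm xn; rewrite /r; lra.
have disj m n x : h m x != 0 -> h n x != 0 -> m = n.
  by move=> hm hn; case: (ltngtP m n) => // mn; [case: (disj_lt m n x)|case: (disj_lt n m x)].
have hlip1 n x y : `|h n x - h n y| <= 1 * mdist x y by rewrite mul1r.
pose H n : LipZ := Lip0 (is_lip0_sub (hlip1 n)).
have HE n x y : H n x - H n y = h n x - h n y by rewrite /= opprB addrA subrK.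
have [|B bB BE] := @analysis_op R Z z0 H 2.
  move=> M x y; apply: (@le_trans _ _
      (\sum_(n < M) ((h n x != 0)%:R + (h n y != 0)%:R) * mdist x y)).
    apply: ler_sum => n _; rewrite HE.
    have := hlip n x y; have := mdist_ge0 x y.
    by case: (eqVneq (h n x) 0) => [->|_]; case: (eqVneq (h n y) 0) => [->|_];
      rewrite ?eqxx/= ?subrr ?normr0; lra.
  rewrite -mulr_suml ler_wpM2r ?mdist_ge0// big_split/=.
  by rewrite lerD// sum_at_most_one// => i j hi hj; apply/val_inj; exact: disj hi hj.
pose v n : LF := (r n)^-1 *: (free_delta z0 (q n) - free_delta z0 p).
have vE n f : v n f = (r n)^-1 * (f (q n) - f p) by [].
have [n|A bA AE] := @synthesis_op R Z z0 v 2 (ler0n _ 2).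
  apply: free_norm_le => // f; rewrite vE normrM gtr0_norm ?invr_gt0// ler_pdivrMl//.
  by rewrite (le_trans (lip0_normP _ _ _))// /r mulrA divfK ?pnatr_eq0// mulrC.
exists A, B; split => // x; apply/ell1P => n; rewrite BE.
apply: (cvg_unique _ (AE x (H n))) => //.
have hp m : h m p = 0.
  apply/eqP/negPn/negP => /h0; have := q0 m.
  by rewrite (metric_sym p) /r; lra.
have hq m k : h m (q k) = (m == k)%:R * r k.
  have hqk : h k (q k) = r k.
    by rewrite /h mdistxx subr0; apply/max_idPr; rewrite ltW.
  have [->|mk] := eqVneq m k; first by rewrite mul1r.
  rewrite mul0r; apply/eqP/negPn/negP => /(@disj m k (q k)) mk'.
  by rewrite mk' ?eqxx// in mk; rewrite hqk gt_eqF.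
have vH m : v m (H n) = (m == n)%:R.
  rewrite vE HE hq hp subr0 (eq_sym m); have [_|_] := eqVneq n m; last by rewrite mul0r mulr0.
  by rewrite mul1r mulVf// gt_eqF.
apply: cvg_near_cst; near=> M.
have nM : (n < M)%N by near: M; exact: nbhs_infty_gt.
under eq_bigr => m _ do rewrite vH.
rewrite (bigD1 (Ordinal nM))//= eqxx mulr1 big1 ?addr0// => m mn.
by rewrite (_ : (m == n :> nat) = false) ?mulr0//; apply: contraNF mn => /eqP mn; apply/eqP/val_inj.
Unshelve. all: by end_near.
Qed.

Lemma ell1_complemented_accumulation (p : Z) :
  (forall e : R, 0 < e -> exists2 q, 0 < mdist q p & mdist q p <= e) ->
  exists (A : ell1 R -> LF) (B : LF -> ell1 R),
    [/\ bounded_op A, bounded_op B & cancel A B].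
Proof.
move=> acc.
have /choice[F HF] : forall e : R, exists q, 0 < e -> 0 < mdist q p /\ mdist q p <= e.
  by move=> e; have [/acc[q ? ?]|] := ltP 0 e; [exists q|exists p].
pose q := fix q n := if n is m.+1 then F (mdist (q m) p / 4) else F 1.
have q0 n : 0 < mdist (q n) p.
  elim: n => [|n IH]; first by have [] := HF 1 ltr01.
  by have [|] := HF (mdist (q n) p / 4); first by rewrite divr_gt0.
apply: (@ell1_complemented p q) => // n.
by have [|] := HF (mdist (q n) p / 4); first by rewrite divr_gt0.
Qed.

End complemented_ell1.

(** * Dyadic sums *)

Section geometric.
Context {R : realType}.

Lemma geometric_le (a : R) n : 0 < a < 1 -> \sum_(k < n) a ^+ k <= (1 - a)^-1.
Proof.
move=> /andP[a0 a1]; rewrite -[leRHS]mul1r ler_pdivlMr ?subr_gt0//.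
by have := subrX1 a n; have := exprn_ge0 n (ltW a0); lra.
Qed.

(** The sum f n t satisfies f (n+1) t = min 1 t + a f n (2 t), which suggests an
induction on n at all scales t at once. The bound C P t alone is not inductive, as
a C P (2 t) = C P t leaves no room for the new term; subtracting E t creates the
room, since a E (2 t) exceeds E t by exactly t when E (2 a - 1) = 1. For t > 1 the
truncation is used instead, and the sum is at most the geometric series. *)
Lemma truncated_geometric_le (a : R) (P : R -> R) :
  0 < a < 1 -> 1 < 2 * a ->
  (forall t, 0 <= t -> a * P (2 * t) = P t) ->
  (forall t, 1 <= t -> 1 <= P t) ->
  (forall t, 0 <= t -> t <= 2 -> t / 2 <= P t) ->
  exists2 C : R, 0 <= C & forall n (t : R), 0 <= t ->
    \sum_(k < n) a ^+ k * Num.min 1 (2 ^+ k * t) <= C * P t.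
Proof.
move=> a01 a2 P2 P1 Phalf; case/andP: (a01) => a0 a1.
set E : R := (2 * a - 1)^-1; set b := (1 - a)^-1; pose C : R := 2 * E + b.
have E0 : 0 < E by rewrite invr_gt0 subr_gt0.
have EE : E * (2 * a - 1) = 1 by rewrite mulVf// gt_eqF// subr_gt0.
have b0 : 0 < b by rewrite invr_gt0 subr_gt0.
have C0 : 0 <= C by rewrite /C addr_ge0// ?mulr_ge0// ltW.
exists C => // n t t0.
have bound m s : \sum_(k < m) a ^+ k * Num.min 1 (2 ^+ k * s) <= b.
  apply: le_trans (geometric_le m a01); apply: ler_sum => k _.
  by apply: ler_piMr; [rewrite exprn_ge0// ltW|rewrite ge_min lexx].
have [t2|t2] := leP t 2; last first.
  apply: le_trans (bound n t) _; apply: le_trans (_ : C * 1 <= _).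
    by rewrite /C mulr1 lerDr mulr_ge0// ltW.
  by rewrite ler_wpM2l// P1// ltW// (le_lt_trans _ t2)// ler1n.
suff : \sum_(k < n) a ^+ k * Num.min 1 (2 ^+ k * t) <= C * P t - E * t.
  by move/le_trans; apply; rewrite gerBl mulr_ge0// ltW.
elim: n t t0 t2 => [|n IH] t t0 t2.
  rewrite big_ord0 subr_ge0; apply: le_trans (_ : 2 * E * (t / 2) <= _); first by lra.
  apply: ler_pM; [by rewrite mulr_ge0// ltW|by rewrite divr_ge0| |exact: Phalf].
  by rewrite /C lerDl ltW.
have [t1|t1] := leP t 1; last first.
  apply: le_trans (bound _ _) _; have /(ler_wpM2l C0) := P1 _ (ltW t1).
  rewrite mulr1 {1}/C; have : E * t <= E * 2 by rewrite ler_wpM2l// ltW.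
  set x := C * P t; set y := E * t; lra.
rewrite big_ord_recl expr0 mul1r mul1r.
have -> : \sum_(i < n) a ^+ (lift ord0 i) * Num.min 1 (2 ^+ (lift ord0 i) * t) =
    a * \sum_(i < n) a ^+ i * Num.min 1 (2 ^+ i * (2 * t)).
  rewrite mulr_sumr; apply: eq_bigr => i _.
  by rewrite !exprS mulrA mulrCA mulrA.
have /(ler_wpM2l (ltW a0)) IHt : \sum_(i < n) a ^+ i * Num.min 1 (2 ^+ i * (2 * t)) <=
    C * P (2 * t) - E * (2 * t).
  by apply: IH; [rewrite mulr_ge0|rewrite -[leRHS]mulr1 ler_wpM2l].
have mint : Num.min 1 t <= t by rewrite ge_min lexx orbT.
have E2 : a * (E * (2 * t)) = E * t + t.
  have -> : a * (E * (2 * t)) = E * t + E * (2 * a - 1) * t by ring.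
  by rewrite EE mul1r.
have E1 : a * (C * P (2 * t)) = C * P t by rewrite mulrCA P2.
rewrite mulrBr E1 E2 in IHt.
apply: le_trans (lerD mint IHt) _.
by set x := C * P t; set y := E * t; lra.
Qed.

Context (alpha : R) (alpha01 : 0 < alpha < 1).
Local Notation a := ((2 : R) `^ (- alpha)).

Lemma halving_ratio01 : 0 < a < 1.
Proof.
case/andP: alpha01 => al0 _; rewrite powR_gt0//= powRN invf_lt1 ?powR_gt0//.
by rewrite /powR pnatr_eq0/= -[ltLHS]expR0 ltr_expR mulr_gt0// ln_gt0// ltr1n.
Qed.

Let a_gt_half : 1 < 2 * a.
Proof.
case/andP: alpha01 => _ al1; rewrite powRN ltr_pdivlMr ?powR_gt0// mul1r.
by rewrite -[ltRHS]powRr1// /powR pnatr_eq0/= ltr_expR ltr_pM2r// ?ln_gt0// ?ltr1n.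
Qed.

Lemma powR_halfX n : (2 ^- n : R) `^ alpha = a ^+ n.
Proof. by rewrite -powR_invn// -powRrM mulrC mulrN -mulNr powRrM powR_mulrn// powR_ge0. Qed.

Lemma snowflake_sum : exists2 C : R, 0 <= C & forall n (t : R), 0 <= t ->
  \sum_(k < n) a ^+ k * Num.min 1 (2 ^+ k * t) <= C * t `^ alpha.
Proof.
case/andP: alpha01 => al0 al1.
apply: (@truncated_geometric_le _ (fun t => t `^ alpha)) => //.
- exact: halving_ratio01.
- move=> t t0; rewrite powRM// mulrA -powRD ?addNr ?powRr0 ?mul1r//.
  by rewrite pnatr_eq0 implybT.
- move=> t t1; rewrite -[leLHS](congr1 (fun f => f alpha) (powR1 R)).
  by rewrite ge0_ler_powR ?nnegrE// ?ltW// (lt_le_trans ltr01).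
- move=> t t0 t2; apply: le_trans (_ : (t / 2) `^ alpha <= _); last first.
    rewrite ge0_ler_powR ?nnegrE ?divr_ge0//; first exact: ltW.
    by rewrite ler_pdivrMr// ler_peMr// ler1n.
  have [->|tn0] := eqVneq t 0; first by rewrite mul0r powR_ge0.
  have tg : 0 < t by rewrite lt_neqAle eq_sym tn0.
  by apply: ger1_powR (ltW al1); rewrite divr_gt0//= ler_pdivrMr// mul1r.
Qed.

End geometric.

(** * Systems of cells and partitions of unity *)

Section cells.
Context {R : realType} {T : Type}.

(** u k i is meant as the distance to the i-th cell of level k, in units of 2^-k
and truncated at 1, and b k i as a point of that cell. The cells
themselves do not appear; the l1 bound [cell_variation] is where the bounded
multiplicity of the cover enters. The first cell of each level contains the
basepoint, so that the code of the basepoint is deterministic, and level 0 has only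
one cell. *)
Record cell_system (d : T -> T -> R) (x0 : T) (C K : R) (N : nat -> nat)
    (u : nat -> nat -> T -> R) (b : nat -> nat -> T) : Prop := CellSystem {
  cell_ge0 : forall k i p, 0 <= u k i p;
  cell_cover : forall k p, exists2 i, (i < N k)%N & u k i p = 0;
  cell_close : forall k i p, (i < N k)%N -> u k i p < 1 -> d p (b k i) <= C * 2 ^- k;
  cell_variation : forall k p q, d p q <= 2 ^- k ->
    \sum_(i < N k) `|u k i p - u k i q| <= K * (2 ^+ k * d p q);
  cell_base : forall k, u k 0%N x0 = 0;
  cell_N0 : N 0%N = 1%N;
  cell_b0 : b 0%N 0%N = x0
}.

Fixpoint residual (u : nat -> T -> R) n p : R :=
  if n is m.+1 then Num.min (residual u m p) (u m p) else 1.

(** [weight u i p] is the length of the set of the thresholds w in [0, 1] for which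
i is the first index with u i p <= w. This is a partition of unity, and unlike a
normalized one it involves no quotient. *)
Definition weight (u : nat -> T -> R) n p : R := residual u n p - residual u n.+1 p.

Lemma residual_ge0 (u : nat -> T -> R) n p : (forall i, 0 <= u i p) -> 0 <= residual u n p.
Proof. by move=> u0; elim: n => //= n IH; rewrite le_min IH u0. Qed.

Lemma residual_le1 (u : nat -> T -> R) n p : residual u n p <= 1.
Proof. by elim: n => //= n IH; rewrite ge_min IH. Qed.

Lemma weight_ge0 u n p : 0 <= weight u n p.
Proof. by rewrite subr_ge0 /= ge_min lexx. Qed.

Lemma weight_neq0 u n p : weight u n p != 0 -> u n p < 1.
Proof.
rewrite /weight /=; case: (ltP (residual u n p) (u n p)); first by rewrite subrr eqxx.
move=> un0; rewrite subr_eq0 => un; apply: lt_le_trans (residual_le1 u n p).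
by rewrite lt_neqAle eq_sym un.
Qed.

Lemma weight_sum u n p : \sum_(i < n) weight u i p = 1 - residual u n p.
Proof.
elim: n => [|n IH]; first by rewrite big_ord0 subrr.
by rewrite big_ord_recr/= IH /weight addrA subrK.
Qed.

Lemma weight_sum1 u n p : (forall i, 0 <= u i p) -> (exists2 i, (i < n)%N & u i p = 0) ->
  \sum_(i < n) weight u i p = 1.
Proof.
move=> u0 [i ni ui]; rewrite weight_sum; apply/eqP; rewrite subr_eq addrC -subr_eq subrr eq_sym.
rewrite eq_le residual_ge0// andbT -ui.
elim: n ni => // n IH; rewrite ltnS leq_eqVlt => /orP[/eqP ->|/IH ni] /=.
  by rewrite ge_min lexx orbT.
by rewrite ge_min ni.
Qed.

(** In the plane of (m, v): moving m shifts only one of m - min m v and min m v,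
and moving v shifts at most both, by no more than v moves. *)
Lemma min_variation (m m' v v' : R) :
  `|m - Num.min m v - (m' - Num.min m' v')| + `|Num.min m v - Num.min m' v'| <=
  `|m - m'| + 2 * `|v - v'|.
Proof.
have abs2 (x y z : R) : x + y <= z -> x - y <= z -> - x + y <= z -> - x - y <= z ->
    `|x| + `|y| <= z by case: (ger0P x); case: (ger0P y); lra.
have := ler_norm (m - m'); have := ler_norm (m' - m); rewrite (distrC m' m).
have := ler_norm (v - v'); have := ler_norm (v' - v); rewrite (distrC v' v).
move: `|m - m'| `|v - v'| => x y h1 h2 h3 h4.
by apply: abs2; case: (ltP m v); case: (ltP m' v'); lra.
Qed.

(** Induction on the number of functions; carrying the variation of the residual
makes each step an instance of [min_variation]. *)
Lemma weight_variation u n p q :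
  \sum_(i < n) `|weight u i p - weight u i q| + `|residual u n p - residual u n q| <=
  2 * \sum_(i < n) `|u i p - u i q|.
Proof.
elim: n => [|n IH]; first by rewrite !big_ord0 subrr normr0 mulr0 addr0.
rewrite !big_ord_recr mulrDr/=.
apply: le_trans (_ : _ <= _ + 2 * `|u n p - u n q|) (lerD IH (lexx _)).
by rewrite -[leLHS]addrA -[leRHS]addrA lerD2l; exact: min_variation.
Qed.

End cells.

(** * The free space of a snowflake is a retract of l1 *)

Section retraction.
Context {R : realType}.

(** Enumerating level after level, rather than through a bijection with triples,
makes the partial sums at the ends of the blocks exact sums over the first levels,
where the series of the retraction telescopes. *)
Lemma block_enumeration (I : eqType) (B : nat -> seq I) (i0 : I) :
  (forall k, (0 < size (B k))%N) ->
  exists (e : nat -> I) (t : nat -> nat), (forall K, (K <= t K)%N) /\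
    (forall n, exists k, e n \in B k) /\
    forall (F : I -> R) K, \sum_(n < t K) F (e n) = \sum_(k < K) \sum_(i <- B k) F i.
Proof.
move=> B0; pose L K := flatten [seq B k | k <- iota 0 K].
have LS K : L K.+1 = L K ++ B K.
  by rewrite /L -addn1 iotaD map_cat flatten_cat/= cats0.
have sizeL K : (K <= size (L K))%N.
  by elim: K => // K IH; rewrite LS size_cat -addn1 leq_add.
have nthL n j m : (n < size (L j))%N -> nth i0 (L (j + m)%N) n = nth i0 (L j) n.
  move=> nj; elim: m => [|m IH]; first by rewrite addn0.
  rewrite addnS LS nth_cat IH; case: ltnP => //.
  have : (size (L j) <= size (L (j + m)))%N.
    elim: (m) => [|m' IH']; first by rewrite addn0.
    by rewrite addnS LS size_cat (leq_trans IH')// leq_addr.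
  by move=> /(leq_trans nj) /leq_trans h /h; rewrite ltnn.
exists (fun n => nth i0 (L n.+1) n), (fun K => size (L K)); split => //; split => [n|F K].
  have /flattenP[s /mapP[k _ ->] ens] := mem_nth i0 (sizeL n.+1).
  by exists k.
transitivity (\sum_(n < size (L K)) F (nth i0 (L K) n)).
  apply: eq_bigr => -[n /= nL] _; congr F; case: (leqP n.+1 K) => nK.
    by have := nthL n n.+1 (K - n.+1)%N (sizeL _); rewrite subnKC// => ->.
  by have := nthL n K (n.+1 - K)%N nL; rewrite subnKC// ltnW.
rewrite -(big_mkord xpredT (fun n => F (nth i0 (L K) n))) -(big_nth i0 xpredT F).
elim: K => [|K IH]; first by rewrite big_ord0 big_nil.
by rewrite LS big_cat IH big_ord_recr.
Qed.

Lemma sum_product_variation (m n : nat) (f f' : 'I_m -> R) (g g' : 'I_n -> R) :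
  (forall i, 0 <= f' i) -> (forall j, 0 <= g j) ->
  \sum_i f' i = 1 -> \sum_j g j = 1 ->
  \sum_i \sum_j `|f i * g j - f' i * g' j| <=
  \sum_i `|f i - f' i| + \sum_j `|g j - g' j|.
Proof.
move=> f0 g0 f1 g1.
apply: le_trans (_ : \sum_i \sum_j (`|f i - f' i| * g j + f' i * `|g j - g' j|) <= _).
  apply: ler_sum => i _; apply: ler_sum => j _.
  have -> : f i * g j - f' i * g' j = (f i - f' i) * g j + f' i * (g j - g' j) by ring.
  by rewrite (le_trans (ler_normD _ _))// !normrM (ger0_norm (g0 j)) (ger0_norm (f0 i)).
under eq_bigr => i _ do rewrite big_split/= -mulr_sumr -mulr_sumr g1 mulr1.
by rewrite big_split/= -mulr_suml f1 mul1r.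
Qed.

Context {Z : metricType R} (z0 : Z) (alpha : R) (alpha01 : 0 < alpha < 1).
Context (d : Z -> Z -> R) (d_ge0 : forall x y, 0 <= d x y).
Context (d_sym : forall x y, d x y = d y x).
Context (d_triangle : forall y x z, d x z <= d x y + d y z).
Context (mdistE : forall x y : Z, mdist x y = d x y `^ alpha).
Context (C K : R) (N : nat -> nat) (u : nat -> nat -> Z -> R) (b : nat -> nat -> Z).
Context (C0 : 0 <= C) (K0 : 0 <= K) (cells : cell_system d z0 C K N u b).
Local Notation LF := (free_space z0).
Local Notation LipZ := (lip0 z0).
Local Notation a := ((2 : R) `^ (- alpha)).

Let w k i p := weight (u k) i p.

Let w_ge0 k i p : 0 <= w k i p. Proof. exact: weight_ge0. Qed.

Let w_sum1 k p : \sum_(i < N k) w k i p = 1.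
Proof. by apply: weight_sum1; [move=> i; exact: cell_ge0 cells _ _ _|exact: cell_cover cells k p]. Qed.

Let w_close k i p : (i < N k)%N -> w k i p != 0 -> d p (b k i) <= C * 2 ^- k.
Proof. by move=> iN wn0; apply: (cell_close cells iN); exact: weight_neq0 wn0. Qed.

(** Below scale 2^-k this is the variation of the cell functions; above it, both
weight vectors are probability vectors, at l1-distance at most 2. *)
Lemma weight_variation_scale k p q :
  \sum_(i < N k) `|w k i p - w k i q| <= (2 * K + 2) * Num.min 1 (2 ^+ k * d p q).
Proof.
have k2 : 0 < 2 ^+ k :> R by rewrite exprn_gt0.
have [dk|dk] := leP (d p q) (2 ^- k).
  have -> : Num.min 1 (2 ^+ k * d p q) = 2 ^+ k * d p q.
    by apply/min_idPr; rewrite -ler_pdivlMl// mulr1.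
  apply: le_trans (_ : 2 * (K * (2 ^+ k * d p q)) <= _).
    apply: le_trans (ler_wpM2l (ler0n _ 2) (cell_variation cells dk)).
    by apply: le_trans (weight_variation (u k) (N k) p q); rewrite lerDl.
  set s := 2 ^+ k * d p q; have s0 : 0 <= s by rewrite mulr_ge0// ltW.
  have -> : (2 * K + 2) * s = 2 * (K * s) + 2 * s by ring.
  by rewrite lerDl mulr_ge0.
have -> : Num.min 1 (2 ^+ k * d p q) = 1.
  by apply/min_idPl; rewrite -ler_pdivrMl// mulr1 ltW.
rewrite mulr1; apply: le_trans (_ : \sum_(i < N k) (w k i p + w k i q) <= _).
  apply: ler_sum => i _; rewrite (le_trans (ler_normB _ _))//.
  by rewrite !ger0_norm// w_ge0.
by rewrite big_split/= !w_sum1; have := K0; lra.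
Qed.

Let B k := [seq (k, (i, j)) | i <- iota 0 (N k.+1), j <- iota 0 (N k)].

Let N_gt0 k : (0 < N k)%N.
Proof. by have [i iN _] := cell_cover cells k z0; exact: leq_ltn_trans iN. Qed.

Let sumB k (F : nat * (nat * nat) -> R) :
  \sum_(t <- B k) F t = \sum_(i < N k.+1) \sum_(j < N k) F (k, (i : nat, j : nat)).
Proof.
rewrite /B big_allpairs_dep/= -[X in iota 0 X]subn0 -/(index_iota _ _) big_mkord.
by apply: eq_bigr => i _; rewrite -[X in iota 0 X]subn0 -/(index_iota _ _) big_mkord.
Qed.

Let psi (t : nat * (nat * nat)) p : R := w t.1.+1 t.2.1 p * w t.1 t.2.2 p.
Let jump (t : nat * (nat * nat)) (f : Z -> R) : R := f (b t.1.+1 t.2.1) - f (b t.1 t.2.2).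

Let psi_variation : exists2 G : R, 0 <= G & forall M p q,
  \sum_(k < M) \sum_(t <- B k) `|a ^+ t.1 * psi t p - a ^+ t.1 * psi t q| <= G * mdist p q.
Proof.
have [G G0 HG] := snowflake_sum alpha01.
have a0 : 0 < a by case/andP: (halving_ratio01 alpha01).
exists (3 * (2 * K + 2) * G) => [|M p q].
  by rewrite !mulr_ge0// addr_ge0// mulr_ge0.
rewrite mdistE -mulrA; apply: le_trans (ler_wpM2l _ (HG M _ (d_ge0 p q))); last first.
  by rewrite mulr_ge0// addr_ge0// mulr_ge0.
rewrite mulr_sumr; apply: ler_sum => k _; rewrite sumB.
under eq_bigr => i _ do under eq_bigr => j _ do
  rewrite /= -mulrBr normrM (ger0_norm (exprn_ge0 _ (ltW a0))).
under eq_bigr => i _ do rewrite -mulr_sumr.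
rewrite -mulr_sumr mulrCA ler_wpM2l ?exprn_ge0 ?(ltW a0)//.
have spv := @sum_product_variation (N k.+1) (N k) (fun i => w k.+1 i p)
  (fun i => w k.+1 i q) (fun j => w k j p) (fun j => w k j q).
apply: le_trans (spv _ _ _ _) _ => //.
apply: le_trans (lerD (weight_variation_scale k.+1 p q) (weight_variation_scale k p q)) _.
set A := 2 * K + 2; have A0 : 0 <= A by rewrite addr_ge0// mulr_ge0.
set s := 2 ^+ k * d p q; have -> : 2 ^+ k.+1 * d p q = 2 * s by rewrite exprS mulrA.
have s0 : 0 <= s by rewrite mulr_ge0// exprn_ge0.
have -> : 3 * A * Num.min 1 s = A * (2 * Num.min 1 s) + A * Num.min 1 s by ring.
rewrite lerD2r ler_wpM2l//.
by case: (ltP 1 s); case: (ltP 1 (2 * s)); lra.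
Qed.

Let average k (f : Z -> R) p := \sum_(i < N k) w k i p * f (b k i).

(** Telescoping: as the weights of each level sum to 1, summing out one of the two
indices leaves the average over a single level. *)
Let sum_jump M (f : Z -> R) p :
  \sum_(k < M) \sum_(t <- B k) psi t p * jump t f = average M f p - average 0 f p.
Proof.
elim: M => [|M IH]; first by rewrite big_ord0 subrr.
rewrite big_ord_recr/= IH sumB addrC.
suff -> : \sum_(i < N M.+1) \sum_(j < N M)
    psi (M, (i : nat, j : nat)) p * jump (M, (i : nat, j : nat)) f =
  average M.+1 f p - average M f p by rewrite addrA subrK.
rewrite /psi /jump /=.
under eq_bigr => i _ do under eq_bigr => j _ do rewrite mulrBr.
under eq_bigr => i _ do rewrite sumrB.
rewrite sumrB; congr (_ - _).
  apply: eq_bigr => i _.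
  by under eq_bigr => j _ do rewrite mulrAC; rewrite -mulr_sumr w_sum1 mulr1.
rewrite exchange_big/=; apply: eq_bigr => j _.
by under eq_bigr => i _ do rewrite -mulrA; rewrite -mulr_suml w_sum1 mul1r.
Qed.

Let average0 f p : average 0 f p = f z0.
Proof.
have N1 := cell_N0 cells; have := w_sum1 0 p; rewrite /average N1 !big_ord1 => ->.
by rewrite mul1r (cell_b0 cells).
Qed.

Let average_close k (f : LipZ) p : `|average k f p - f p| <= `|f| * (C `^ alpha) * a ^+ k.
Proof.
have -> : average k f p - f p = \sum_(i < N k) w k i p * (f (b k i) - f p).
  under [RHS]eq_bigr => i _ do rewrite mulrBr.
  by rewrite sumrB -mulr_suml w_sum1 mul1r.
apply: le_trans (ler_norm_sum _ _ _) _.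
apply: le_trans (_ : \sum_(i < N k) w k i p * (`|f| * C `^ alpha * a ^+ k) <= _); last first.
  by rewrite -mulr_suml w_sum1 mul1r.
apply: ler_sum => i _; rewrite normrM ger0_norm//.
have [->|wn0] := eqVneq (w k i p) 0; first by rewrite !mul0r.
rewrite ler_wpM2l// (le_trans (lip0_normP _ _ _))// -mulrA ler_wpM2l// mdistE.
have [al0 _] := andP alpha01.
rewrite -powR_halfX -powRM ?invr_ge0 ?exprn_ge0//.
rewrite ge0_ler_powR ?nnegrE ?mulr_ge0 ?invr_ge0 ?exprn_ge0 ?(ltW al0)//.
by rewrite d_sym w_close.
Qed.

(** The coordinates g n are a^k psi, recentered to vanish at z0, and the vectors v n
are the differences of evaluations divided by a^k; their product is the telescoping
series of [sum_jump]. *)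
Theorem free_space_retract_ell1 : exists (S : LF -> ell1 R) (T : ell1 R -> LF),
  [/\ bounded_op S, bounded_op T & cancel S T].
Proof.
have [a0 a1] := andP (halving_ratio01 alpha01); have [al0 _] := andP alpha01.
have [e [t [tK [eB sume]]]] : exists (e : nat -> nat * (nat * nat)) (t : nat -> nat),
    (forall M, (M <= t M)%N) /\ (forall n, exists k, e n \in B k) /\
    forall (F : nat * (nat * nat) -> R) M,
      \sum_(n < t M) F (e n) = \sum_(k < M) \sum_(i <- B k) F i.
  apply: (block_enumeration (0, (0, 0))%N) => k.
  by rewrite size_allpairs !size_iota muln_gt0 !N_gt0.
have [G G0 HG] := psi_variation.
pose g0 n p : R := a ^+ (e n).1 * psi (e n) p.
have g0sum M p q : \sum_(n < M) `|g0 n p - g0 n q| <= G * mdist p q.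
  apply: le_trans (HG M p q).
  rewrite -(sume (fun t => `|a ^+ t.1 * psi t p - a ^+ t.1 * psi t q|)).
  rewrite -!(big_mkord xpredT (fun n => `|g0 n p - g0 n q|)).
  by rewrite [leRHS](big_cat_nat (leq0n M) (tK M))/= lerDl sumr_ge0.
have g0lip n p q : `|g0 n p - g0 n q| <= G * mdist p q.
  by apply: le_trans (g0sum n.+1 p q); rewrite big_ord_recr/= lerDr sumr_ge0.
pose g n : LipZ := Lip0 (is_lip0_sub z0 (g0lip n)).
have gE n p q : g n p - g n q = g0 n p - g0 n q by rewrite /= opprB addrA subrK.
have [M x y|S bS SE] := @analysis_op R Z z0 g G.
  by under eq_bigr => n _ do rewrite gE; exact: g0sum.
(* Only pairs of cells at distance O(2^-k) have a nonzero product of weights; the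
   others are sent to 0 to keep the v n bounded. *)
pose near_pair (t : nat * (nat * nat)) := d (b t.1.+1 t.2.1) (b t.1 t.2.2) <= 2 * C * 2 ^- t.1.
pose v n : LF := if near_pair (e n) then
  a ^- (e n).1 *: (free_delta z0 (b (e n).1.+1 (e n).2.1) - free_delta z0 (b (e n).1 (e n).2.2))
  else 0.
have vE n f : v n f = if near_pair (e n) then a ^- (e n).1 * jump (e n) f else 0.
  by rewrite /v; case: ifP.
have [||T bT TE] := @synthesis_op R Z z0 v ((2 * C) `^ alpha).
- exact: powR_ge0.
- move=> n; apply: free_norm_le => [|f]; first exact: powR_ge0.
  rewrite vE; case: ifPn => [nr|_]; last by rewrite normr0 mulr_ge0 ?powR_ge0.
  rewrite normrM ger0_norm ?invr_ge0 ?exprn_ge0 ?(ltW a0)// ler_pdivrMl ?exprn_gt0//.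
  apply: le_trans (lip0_normP _ _ _) _; rewrite mulrA [leRHS]mulrC ler_wpM2l// mdistE.
  rewrite mulrC -powR_halfX -powRM ?mulr_ge0 ?invr_ge0 ?exprn_ge0//.
  by rewrite ge0_ler_powR ?nnegrE ?mulr_ge0 ?invr_ge0 ?exprn_ge0 ?(ltW al0).
exists S, T; split => // phi.
apply: (free_op_ext (bounded_op_comp bT bS) (@bounded_op_id R LF)) => {phi} p.
apply: freeP => f; rewrite free_deltaE.
(* The full series converges, so its limit may be computed along block ends. *)
have cvt : t @ \oo --> \oo.
  by apply/cvgnyPge => A; near=> n; apply: leq_trans (tK n); near: n; exact: nbhs_infty_ge.
apply: (cvg_unique _ (cvg_comp _ _ cvt (TE (S (free_delta z0 p)) f))) => //=.
have psi_far n q : ~~ near_pair (e n) -> psi (e n) q = 0.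
  have [k /allpairsP[[i j] /= [iN jN ->]]] := eB n; rewrite /near_pair /psi/=.
  rewrite mem_iota/= add0n in iN; rewrite mem_iota/= add0n in jN.
  apply: contraNeq; rewrite mulf_eq0 negb_or => /andP[wi wj].
  rewrite (le_trans (d_triangle q _ _))//.
  have := w_close iN wi; have := w_close jN wj; rewrite (d_sym _ q).
  rewrite exprS invfM; have : 0 <= C * 2 ^- k by rewrite mulr_ge0// invr_ge0 exprn_ge0.
  move: (2 ^- k) => h; rewrite -(mulrA 2) (mulrCA C); move: (C * h) => x; lra.
have partial M : \sum_(n < t M) S (free_delta z0 p) n * v n f = average M f p - average M f z0.
  transitivity (\sum_(n < t M) (psi (e n) p * jump (e n) f - psi (e n) z0 * jump (e n) f)).
    apply: eq_bigr => n _; rewrite SE free_deltaE vE -mulrBl.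
    have -> : g n p = a ^+ (e n).1 * (psi (e n) p - psi (e n) z0) by rewrite mulrBr.
    have [_|/psi_far far] := boolP (near_pair _); last by rewrite !far subrr mulr0 mul0r.
    by rewrite mulrACA divff ?mul1r// gt_eqF// exprn_gt0.
  rewrite sumrB !(sume (fun t => psi t _ * jump t f)) !sum_jump !average0.
  by rewrite opprB addrA subrK.
apply/cvgrPdist_le => eps eps0.
pose D := `|f| * C `^ alpha.
have cvg0 : geometric (D + D) a @ \oo --> 0 by apply: cvg_geometric; rewrite gtr0_norm.
have /cvgrPdist_le/(_ _ eps0) := cvg0; apply: filterS => M.
rewrite sub0r normrN => DM.
rewrite -[X in `|_ - X|]/(\sum_(n < t M) S (free_delta z0 p) n * v n f) partial.
have f0 : f z0 = 0 by exact: lip0_base.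
have -> : f p - (average M f p - average M f z0) =
    (average M f z0 - f z0) - (average M f p - f p) by rewrite f0; ring.
apply: le_trans (ler_normB _ _) _.
apply: le_trans (lerD (average_close _ _ _) (average_close _ _ _)) _.
by apply: le_trans (ler_norm _) _; rewrite -mulrDl.
Unshelve. all: by end_near.
Qed.

End retraction.

(** * Cells in compact spaces of finite Nagata dimension *)


Section nagata_cells.
Context {R : realType} (X : metricType R).
Implicit Types (A B : set X) (p q x y : X).

Lemma diam_le A (t : R) : 0 <= t -> (forall x y, A x -> A y -> mdist x y <= t) ->
  (diam A <= t%:E)%E.
Proof.
move=> t0 At; rewrite ge_max lee_fin t0/=; apply: ub_ereal_sup => _ [[x y] [Ax Ay] <-].
by rewrite lee_fin At.
Qed.

Lemma mdist_le_diam A (t : R) x y : (diam A <= t%:E)%E -> A x -> A y -> mdist x y <= t.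
Proof.
rewrite ge_max => /andP[_ At] Ax Ay; rewrite -lee_fin; apply: le_trans At.
by apply: ereal_sup_ubound; exists (x, y).
Qed.

Lemma card_le_seq (T : choiceType) (s : seq T) (D : set T) (n : nat) :
  uniq s -> (forall z, z \in s -> D z) -> (D #<= `I_n)%card -> (size s <= n)%N.
Proof.
move=> us sD Dn; rewrite -card_le_II; apply: card_le_trans Dn.
have /card_eq_fsetP/card_eqPle[_ h] := card_fseq s.
rewrite undup_id// in h; apply: card_le_trans h _; apply: subset_card_le => z /=.
by rewrite !inE; exact: sD.
Qed.

Definition set_dist p B : R := inf [set mdist p y | y in B].

Lemma set_dist_ge0 p B : 0 <= set_dist p B.
Proof.
rewrite /set_dist; have [->|/set0P ne] := eqVneq [set mdist p y | y in B] set0.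
  by rewrite inf0.
by apply: lb_le_inf => // _ [y _ <-]; exact: mdist_ge0.
Qed.

Lemma set_dist_le p B y : B y -> set_dist p B <= mdist p y.
Proof. by move=> By; apply: ge_inf; [exists 0 => _ [z _ <-]; exact: mdist_ge0|exists y]. Qed.

Lemma set_dist0 p B : B p -> set_dist p B = 0.
Proof.
by move=> Bp; apply/eqP; rewrite eq_le set_dist_ge0 andbT -(mdistxx p) set_dist_le.
Qed.

Lemma set_dist_lt p B t : B !=set0 -> set_dist p B < t -> exists2 y, B y & mdist p y < t.
Proof.
move=> [y By] /inf_lt[]; first by exists (mdist p y), y.
by move=> _ [z Bz <-] zt; exists z.
Qed.

Lemma set_dist_lipschitz p q B : B !=set0 -> `|set_dist p B - set_dist q B| <= mdist p q.
Proof.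
move=> B0; have half x y : set_dist x B - set_dist y B <= mdist x y.
  rewrite lerBlDr -lerBlDl; apply: lb_le_inf; first by case: B0 => z Bz; exists (mdist y z), z.
  move=> _ [z Bz <-]; rewrite lerBlDl (le_trans (set_dist_le x Bz))//.
  exact: metric_triangle.
by rewrite ler_norml lerNl opprB half andbT metric_sym half.
Qed.

Lemma compact_finite_balls (x0 : X) (e : X -> R) : compact [set: X] -> (forall p, 0 < e p) ->
  exists D : {fset X}, forall y, exists2 p, p \in D & mdist p y < e p.
Proof.
move=> cX e0.
pose PX : ptopologicalType := HB.pack (Metric.sort X) (isPointed.Build (Metric.sort X) x0).
have : @cover_compact X [set: X].
  by have := cX; rewrite -[@compact X _]/(@compact PX _) compact_cover.
move=> /(_ X [set: X] (fun p => (ball p (e p))^°)).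
case=> [p _|p _|D _ Dcov]; first exact: open_interior.
  by exists p => //; exact: nbhsx_ballx.
exists D => y; have [p Dp /interior_subset] := Dcov y I.
by rewrite ballEmdist; exists p.
Qed.

Lemma compact_accumulation (x0 : X) : infinite_set [set: X] -> compact [set: X] ->
  exists p, forall e : R, 0 < e -> exists2 q, 0 < mdist q p & mdist q p < e.
Proof.
move=> iX cX; apply: contrapT => noacc.
have /choice[e eP] : forall p, exists e : R, 0 < e /\ forall q, mdist p q < e -> q = p.
  move=> p; apply: contrapT => noe; apply: noacc; exists p => e e0.
  apply: contrapT => noq; apply: noe; exists e; split => // q pq.
  apply/eqP/negPn/negP => qp; apply: noq; exists q; first by rewrite mdist_gt0.
  by rewrite metric_sym.
have [D Dcov] := compact_finite_balls x0 cX (fun p => (eP p).1).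
apply: iX; apply: (@sub_finite_set _ _ [set` D]); last exact: finite_fset.
by move=> q _; have [p Dp /(eP p).2 ->] := Dcov q.
Qed.

(** The cover is taken at scale 4 h: the points within 2 h of p form a set of
diameter at most 4 h, and if mdist p q <= h then any cell whose truncated distance
is below 1 at p or at q meets that set. So at most n + 1 cells of the cover
contribute to the variation, and each by a (1/h)-Lipschitz function; the singleton
of x0, put in front, is the (n+2)-nd. *)
Lemma nagata_scale_cells (n : nat) (gamma h : R) (x0 : X) :
  compact [set: X] -> has_nagata_dim X n gamma -> 0 < h ->
  exists (N : nat) (u : nat -> X -> R) (b : nat -> X),
    [/\ forall i p, 0 <= u i p,
        forall p, exists2 i, (i < N)%N & u i p = 0,
        forall i p, (i < N)%N -> u i p < 1 -> mdist p (b i) <= (1 + 4 * `|gamma|) * h,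
        forall p q, mdist p q <= h ->
          \sum_(i < N) `|u i p - u i q| <= n.+2%:R * (h^-1 * mdist p q) &
        u 0%N x0 = 0].
Proof.
move=> cX nag h0.
have [C [Ccov Cdiam Ccard]] := nag (4 * h) (mulr_gt0 (ltr0n _ 4) h0).
pose near p := [set z | mdist p z <= 2 * h].
have near_diam p : (diam (near p) <= (4 * h)%:E)%E.
  apply: diam_le => [|x y px py]; first by rewrite mulr_ge0// ltW.
  have := metric_triangle x p y; rewrite (metric_sym x p).
  by move: px py; rewrite /near /=; lra.
have finC : finite_set [set B | C B /\ B !=set0].
  have [D Dcov] := compact_finite_balls x0 cX (fun=> h0).
  apply: (@sub_finite_set _ _ (\bigcup_(p in [set` D]) [set B | C B /\ near p `&` B !=set0])).
    move=> B [CB [y By]]; have [p Dp py] := Dcov y.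
    exists p => //; split => //; exists y; split => //.
    by rewrite /near /=; lra.
  apply: bigcup_finite => [|p _]; first exact: finite_fset.
  exact: card_le_finite (Ccard _ (near_diam p)) (finite_II _).
have /finite_seqP[s0 s0E] := finC.
pose s := undup s0; pose cl := [set x0] :: s.
have sP B : B \in s -> C B /\ B !=set0.
  by rewrite mem_undup => Bs; have : [set` s0] B by []; rewrite -s0E.
have clP B : B \in cl -> B !=set0 /\ forall x y, B x -> B y -> mdist x y <= 4 * `|gamma| * h.
  rewrite inE => /orP[/eqP ->|/sP[CB B0]].
    split; first by exists x0.
    by move=> x y -> ->; rewrite mdistxx !mulr_ge0// ltW.
  split=> // x y Bx By; apply: le_trans (mdist_le_diam (Cdiam _ CB) Bx By) _.
  by rewrite [leLHS]mulrCA -[leRHS]mulrA ler_wpM2l// ler_wpM2r ?ler_norm// ltW.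
pose cell i := nth set0 cl i.
pose u i p := Num.min 1 (set_dist p (cell i) / h).
have u_lt1 i p : u i p < 1 -> set_dist p (cell i) < h.
  by rewrite /u; case: (ltP 1 _); rewrite ?ltxx// => _; rewrite ltr_pdivrMr// mul1r.
have u_0 i p : cell i p -> u i p = 0.
  by move=> cp; rewrite /u set_dist0// mul0r; apply/min_idPr.
exists (size cl), u, (fun i => xget x0 (cell i)); split.
- by move=> i p; rewrite le_min ler01 divr_ge0 ?set_dist_ge0// ltW.
- move=> p; have [B CB Bp] : (\bigcup_(B in C) B) p by rewrite Ccov.
  have Bcl : B \in cl.
    rewrite inE mem_undup; apply/orP; right.
    suff : [set` s0] B by []; rewrite -s0E; split => //; by exists p.
  exists (index B cl); first by rewrite index_mem.
  by apply: u_0; rewrite /cell nth_index.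
- move=> i p icl /u_lt1; have [ne dle] := clP _ (mem_nth set0 icl).
  move=> /(set_dist_lt ne)[y cy py]; have := xgetPex x0 ne; rewrite -/(cell i) => cx.
  rewrite (le_trans (metric_triangle p y _))// mulrDl mul1r lerD ?(ltW py)//.
  exact: dle.
- move=> p q pq.
  have u_lip B : B !=set0 ->
      `|Num.min 1 (set_dist p B / h) - Num.min 1 (set_dist q B / h)| <= h^-1 * mdist p q.
    move=> B0; apply: le_trans (_ : `|set_dist p B / h - set_dist q B / h| <= _).
      move: (set_dist p B / h) (set_dist q B / h) => v w.
      have := ler_norm (v - w); have := ler_norm (w - v); rewrite (distrC w v).
      by move: `|v - w| => z; rewrite ler_norml; case: (ltP 1 v); case: (ltP 1 w); lra.
    rewrite -mulrBl normrM mulrC (gtr0_norm (_ : 0 < h^-1)) ?invr_gt0//.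
    by rewrite ler_wpM2l ?invr_ge0 ?set_dist_lipschitz// ltW.
  pose V B := `|Num.min 1 (set_dist p B / h) - Num.min 1 (set_dist q B / h)|.
  rewrite -(big_mkord xpredT (fun i => V (cell i))) -(big_nth set0 xpredT V) big_cons.
  rewrite -addn1 natrD mulrDl mul1r addrC lerD//; last by apply: u_lip; exists x0.
  have V0 B : B \in s -> ~~ `[< near p `&` B !=set0 >] -> V B = 0.
    move=> Bs /asboolPn far; have [_ ne] := sP _ Bs.
    have far_dist z : mdist p z <= h -> 1 <= set_dist z B / h.
      move=> pz; rewrite ler_pdivlMr// mul1r leNgt; apply/negP => /(set_dist_lt ne)[y By zy].
      apply: far; exists y; split => //; rewrite /near /=.
      by have := metric_triangle p z y; lra.
    by rewrite /V !min_l ?subrr ?normr0// far_dist// mdistxx ltW.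
  rewrite (bigID (fun B => `[< near p `&` B !=set0 >]))/= [X in _ + X]big1_seq ?addr0; last first.
    by move=> B /andP[nB Bs]; exact: V0.
  rewrite -big_filter; set f := [seq B <- s | _].
  apply: le_trans (_ : \sum_(B <- f) h^-1 * mdist p q <= _).
    rewrite big_seq [leRHS]big_seq; apply: ler_sum => B.
    by rewrite mem_filter => /andP[_ /sP[_ /u_lip]].
  rewrite big_const_seq count_predT iter_addr_0 -[leLHS]mulr_natl ler_wpM2r//.
    by rewrite mulr_ge0 ?mdist_ge0// invr_ge0 ltW.
  rewrite ler_nat; apply: card_le_seq (Ccard _ (near_diam p)).
    by rewrite filter_uniq// undup_uniq.
  by move=> B; rewrite mem_filter => /andP[/asboolP nB /sP[CB _]].
- by apply: u_0.
Qed.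

Lemma nagata_cell_system (x0 : X) : compact [set: X] -> finite_nagata_dim X ->
  exists (C K : R) (N : nat -> nat) (u : nat -> nat -> X -> R) (b : nat -> nat -> X),
    [/\ 0 <= C, 0 <= K & cell_system (@mdist R X) x0 C K N u b].
Proof.
move=> cX [n [gamma nag]].
have half0 k : 0 < 2 ^- k :> R by rewrite invr_gt0 exprn_gt0.
pose lvl k (t : nat * ((nat -> X -> R) * (nat -> X))) :=
    [/\ forall i p, 0 <= t.2.1 i p,
        forall p, exists2 i, (i < t.1)%N & t.2.1 i p = 0,
        forall i p, (i < t.1)%N -> t.2.1 i p < 1 ->
          mdist p (t.2.2 i) <= (1 + 4 * `|gamma|) * 2 ^- k,
        forall p q, mdist p q <= 2 ^- k ->
          \sum_(i < t.1) `|t.2.1 i p - t.2.1 i q| <= n.+2%:R * (2 ^+ k * mdist p q) &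
        t.2.1 0%N x0 = 0].
have /choice[t tP] : forall k, exists t, lvl k t.
  move=> k; have [N [u [b H]]] := nagata_scale_cells x0 cX nag (half0 k).
  by exists (N, (u, b)); rewrite invrK in H.
(* X is bounded, being covered by finitely many cells of bounded size; this makes
   the one-cell level 0 legitimate. *)
have [D D0 HD] : exists2 D : R, 0 <= D & forall p, mdist p x0 <= D.
  have [u0 ucov uclose _ _] := tP 0%N.
  exists (\sum_(i < (t 0%N).1) mdist ((t 0%N).2.2 i) x0 + (1 + 4 * `|gamma|)) => [|p].
    apply: addr_ge0; last by rewrite addr_ge0// mulr_ge0.
    by apply: sumr_ge0 => i _; exact: mdist_ge0.
  have [i iN ui] := ucov p; rewrite (le_trans (metric_triangle p ((t 0%N).2.2 i) _))// addrC lerD//.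
    by rewrite (bigD1 (Ordinal iN))//= lerDl sumr_ge0// => j _; exact: mdist_ge0.
  by have := uclose _ p iN; rewrite ui expr0 invr1 mulr1; apply.
(* Level 0 is replaced by the whole space. *)
exists ((1 + 4 * `|gamma|) + D), n.+2%:R,
  (fun k => if k is 0%N then 1%N else (t k).1),
  (fun k => if k is 0%N then (fun _ _ => 0) else (t k).2.1),
  (fun k => if k is 0%N then (fun=> x0) else (t k).2.2).
have g0 : 0 <= 1 + 4 * `|gamma| by rewrite addr_ge0// mulr_ge0.
split; [exact: addr_ge0|exact: ler0n|split => //].
- by move=> [|k] i p //; have [] := tP k.+1.
- by move=> [|k] p; [exists 0%N|have [_ + _ _ _] := tP k.+1; exact].
- move=> [|k] i p.
    by move=> _ _; rewrite expr0 invr1 mulr1 (le_trans (HD p))// lerDr.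
  move=> iN ui; have [_ _ /(_ i p iN ui) H _ _] := tP k.+1.
  by rewrite (le_trans H)// ler_wpM2r// ?(ltW (half0 _))// lerDl.
- move=> [|k] p q.
    by rewrite big_ord1 subrr normr0 => _; rewrite !mulr_ge0 ?mdist_ge0// exprn_ge0.
  by have [_ _ _ + _] := tP k.+1; exact.
- by move=> [|k] //; have [] := tP k.+1.
Qed.

End nagata_cells.

(** * The ultrametric space of codes *)

Section code_space.
Context {R : realType}.

Definition code_space (a : R) (a01 : 0 < a < 1) : Type := nat -> nat.

Context (a : R) (a01 : 0 < a < 1).
Local Notation Y := (code_space a01).
Implicit Types u v w : Y.

HB.instance Definition _ := Choice.on Y.

Definition agree u v (k : nat) : Prop := forall i, (i < k)%N -> u i = v i.

Let code_dist u v : R :=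
  if pselect (exists k, u k != v k) is left h then a ^+ ex_minn h else 0.

Let a_gt0 : 0 < a. Proof. by case/andP: a01. Qed.
Let a_lt1 : a < 1. Proof. by case/andP: a01. Qed.

Let code_distP u v : u = v /\ code_dist u v = 0 \/
  exists k, [/\ agree u v k, u k <> v k & code_dist u v = a ^+ k].
Proof.
rewrite /code_dist; case: pselect => [h|h]; last first.
  left; split => //; apply/funext => k; apply/eqP/negPn/negP => uv.
  by apply: h; exists k.
right; case: ex_minnP => k /eqP ukv kmin; exists k; split => // i ik.
by apply/eqP/negPn/negP => /kmin; rewrite leqNgt ik.
Qed.

Let code_dist_leP u v k : code_dist u v <= a ^+ k <-> agree u v k.
Proof.
case: (code_distP u v) => [[-> ->]|[m [uvm ukv ->]]].
  by split=> // _; rewrite exprn_ge0// ltW.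
rewrite ler_iXn2l//; split=> [km i ik|uvk]; first exact/uvm/(leq_trans ik).
by rewrite leqNgt; apply/negP => /uvk.
Qed.

Let code_dist_ge0 u v : 0 <= code_dist u v.
Proof. by case: (code_distP u v) => [[_ ->]|[m [_ _ ->]]] //; rewrite exprn_ge0// ltW. Qed.

Let code_dist_ultra u v w : code_dist u w <= Num.max (code_dist u v) (code_dist v w).
Proof.
case: (code_distP u w) => [[_ ->]|[m [_ uw ->]]]; first by rewrite le_max code_dist_ge0.
rewrite leNgt; apply/negP; rewrite gt_max => /andP[].
have lt_agree x y : code_dist x y < a ^+ m -> agree x y m.+1.
  move=> xy; apply/code_dist_leP; move: xy.
  case: (code_distP x y) => [[_ ->]|[k [_ _ ->]]]; first by rewrite exprn_ge0// ltW.
  by rewrite ltr_iXn2l// ler_iXn2l.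
by move=> /lt_agree uv /lt_agree vw; apply: uw; rewrite uv// vw.
Qed.

Let code_distxx u : code_dist u u = 0.
Proof. by case: (code_distP u u) => [[]|[k [_]]]. Qed.

Let code_dist_eq0 u v : code_dist u v = 0 -> u = v.
Proof.
case: (code_distP u v) => [[]|[k [_ _ ->]]] // /eqP.
by rewrite gt_eqF// exprn_gt0.
Qed.

Let code_dist_sym u v : code_dist u v = code_dist v u.
Proof.
have le x y : code_dist x y <= code_dist y x.
  case: (code_distP y x) => [[-> ->] //|[k [yx _ ->]]].
  by apply/code_dist_leP => i ik; rewrite yx.
by apply/eqP; rewrite eq_le !le.
Qed.

Let code_dist_triangle v u w : code_dist u w <= code_dist u v + code_dist v w.
Proof.
apply: le_trans (code_dist_ultra u v w) _.
by rewrite ge_max lerDl lerDr !code_dist_ge0.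
Qed.

HB.instance Definition _ := @isMetric.Build R Y code_dist
  code_distxx code_dist_eq0 code_dist_sym code_dist_triangle.

Lemma code_space_ultrametric : ultrametric Y.
Proof. exact: code_dist_ultra. Qed.

Lemma code_mdistP u v : u = v /\ mdist u v = 0 \/
  exists k, [/\ agree u v k, u k <> v k & mdist u v = a ^+ k].
Proof. exact: code_distP. Qed.

Lemma code_mdist_leP u v k : mdist u v <= a ^+ k <-> agree u v k.
Proof. exact: code_dist_leP. Qed.

Lemma code_geometric_small (e : R) : 0 < e -> exists k, a ^+ k < e.
Proof.
move=> e0; have cv : geometric 1 a @ \oo --> 0 by apply: cvg_geometric; rewrite gtr0_norm.
have /cvgrPdist_lt/(_ _ e0)[k _ /(_ k (leqnn k))] := cv.
by rewrite sub0r normrN /= mul1r ger0_norm ?exprn_ge0 ?ltW// => ?; exists k.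
Qed.

Definition cylinder (l : seq nat) : set Y :=
  [set u | forall i, (i < size l)%N -> u i = nth 0%N l i].

Lemma code_open_cylinders (U : set Y) : open U ->
  U = \bigcup_(l in [set l | cylinder l `<=` U]) cylinder l.
Proof.
move=> oU; apply/seteqP; split => [u Uu|u [l /= lU]]; last exact: lU.
have /nbhs_ballP[e /= e0 eU] := open_nbhs_nbhs (conj oU Uu).
have [k ke] := code_geometric_small e0.
exists (mkseq u k) => [v /= kv|i /=]; last first.
  by rewrite size_mkseq => ik; rewrite nth_mkseq.
 apply: eU; rewrite ballEmdist /=; apply: le_lt_trans ke.
by apply/code_mdist_leP => i ik; rewrite kv ?size_mkseq// nth_mkseq.
Qed.

Lemma code_space_separable : separable_set [set: Y].
Proof.
exists [set u : Y | exists l : seq nat, u = (fun i => nth 0%N l i)].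
  have -> : [set u : Y | exists l : seq nat, u = (fun i => nth 0%N l i)] =
      [set ((fun i => nth 0%N l i) : Y) | l in [set: seq nat]].
    by apply/seteqP; split => u [l]; [move=> ->; exists l|move=> _ <-; exists l].
  by apply: card_le_trans (card_image_le _ _) _; exact: countableP.
split => // u _ B /nbhs_ballP[e /= e0 eB]; have [k ke] := code_geometric_small e0.
exists (fun i => nth 0%N (mkseq u k) i); split; first by exists (mkseq u k).
apply: eB; rewrite ballEmdist /=; apply: le_lt_trans ke.
by apply/code_mdist_leP => i ik; rewrite nth_mkseq.
Qed.

(** There are countably many cylinders and they form a base of the topology, so
measurability of the coordinates gives that of the preimages of open sets. *)
Lemma code_valued_measurable d (W : measurableType d) (f : W -> Y) :
  (forall k m, measurable [set w | f w k = m]) ->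
  forall B : set Y, <<s @open Y >> B -> measurable [set w | B (f w)].
Proof.
move=> mf; apply: smallest_sub => [|U oU].
  split; first by rewrite (_ : [set w | _] = set0)//; apply/seteqP; split.
    move=> B mB; rewrite setTD (_ : [set w | _] = ~` [set w | B (f w)])//.
    exact: measurableC.
  move=> F mF; rewrite (_ : [set w | _] = \bigcup_i [set w | F i (f w)])//.
  exact: bigcupT_measurable.
have mcyl l : measurable [set w | cylinder l (f w)].
  rewrite (_ : [set w | _] = \bigcap_i [set w | (i < size l)%N -> f w i = nth 0%N l i]).
    apply: bigcapT_measurable => i; case: ltnP => _.
      rewrite (_ : [set w | _] = [set w | f w i = nth 0%N l i]); first exact: mf.
      by apply/seteqP; split => w /= h //; exact: h.
    by rewrite (_ : [set w | _] = setT)//; apply/seteqP; split.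
  by apply/seteqP; split => w cw i; [move=> _; exact: cw|exact: cw].
rewrite [U]code_open_cylinders//.
rewrite (_ : [set w | _] =
    \bigcup_l (if pselect (cylinder l `<=` U) then [set w | cylinder l (f w)] else set0)).
  apply: countable_bigcupT_measurable => [|l]; first exact: countableP.
  by case: pselect => lU; [exact: mcyl|exact: measurable0].
apply/seteqP; split => w.
  by move=> [l /= lU wl]; exists l => //; case: pselect.
by move=> [l _]; case: pselect => //= lU wl; exists l.
Qed.

End code_space.

(** * Random codes *)

Section random_codes.
Context {R : realType}.

(** The integral of a nonnegative function is a supremum over the simple functions
below it, which is monotone without any measurability. *)
Lemma ge0_le_integral_nonmeasurable d (W : measurableType d) (mu : {measure set W -> \bar R})
    (f g : W -> \bar R) : (forall x, 0 <= f x)%E -> (forall x, f x <= g x)%E ->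
  (\int[mu]_x f x <= \int[mu]_x g x)%E.
Proof.
move=> f0 fg; rewrite !ge0_integralTE//; last by move=> x; exact: le_trans (fg x).
by apply: le_ereal_sup => _ [h hf <-]; exists h => // x; exact: le_trans (fg x).
Qed.

(** The distance a^k is paid only if the letters differ at k, so the distance is at
most the sum of the a^k over the levels k where they differ. *)
Lemma expected_code_distance d (W : measurableType d) (P : probability W R)
    (a : R) (a01 : 0 < a < 1) (phi psi : W -> code_space a01) (e : nat -> R) (B : R) :
  (forall k, measurable [set w | phi w k != psi w k]) ->
  (forall k, P [set w | phi w k != psi w k] <= (e k)%:E)%E ->
  (forall n, \sum_(k < n) a ^+ k * e k <= B) ->
  ('E_P[fun w => mdist (phi w) (psi w)] <= B%:E)%E.
Proof.
have [a0 _] := andP a01; move=> mS Pe eB.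
rewrite unlock; pose S k := [set w | phi w k != psi w k].
pose f k (w : W) : \bar R := (a ^+ k * \1_(S k) w)%:E.
have f0 k w : (0 <= f k w)%E by rewrite lee_fin mulr_ge0// exprn_ge0// ltW.
have mf k : measurable_fun setT (f k).
  by apply/measurable_EFinP; apply: measurable_funM => //; apply: measurable_indic; exact: mS.
apply: (@le_trans _ _ (\int[P]_w (\sum_(k <oo) f k w))%E).
  apply: ge0_le_integral_nonmeasurable => [w|w]; first by rewrite lee_fin mdist_ge0.
  case: (code_mdistP (phi w) (psi w)) => [[_ ->]|[k [_ ukv ->]]].
    by apply: nneseries_ge0 => k _ _.
  apply: le_trans (nneseries_lim_ge k.+1 _) => //.
  rewrite big_nat_recr//= -[leLHS]add0e leeD//; first exact: sume_ge0.
  by rewrite /f indicE mem_set ?mulr1//; apply/eqP.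
rewrite integral_nneseries//.
apply: lime_le; first by apply: is_cvg_nneseries => k _ _; apply: integral_ge0.
apply: nearW => n; rewrite big_mkord.
apply: (@le_trans _ _ (\sum_(k < n) (a ^+ k * e k)%:E)%E).
  apply: lee_sum => k _.
  have -> : (\int[P]_x f k x = (a ^+ k)%:E * P (S k))%E.
    rewrite /f (integralZl_indic _ (fun=> S k)).
    - by rewrite integral_indic ?setIT//; exact: mS.
    - exact: measurableT.
    - by move=> ak; have := lt_le_trans ak (exprn_ge0 k (ltW a0)); rewrite ltxx.
    - exact: mS.
  by rewrite EFinM; apply: lee_wpmul2l; [rewrite lee_fin exprn_ge0// ltW|exact: Pe].
by rewrite sumEFin lee_fin.
Qed.

Local Notation U01 := (uniform_prob (@ltr01 R)).

Lemma uniform01E (A : set (measurableTypeR R)) : measurable A ->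
  U01 A = lebesgue_measure (A `&` `[0, 1]).
Proof.
move=> mA; rewrite /uniform_prob integral_uniform_pdf.
rewrite (eq_integral (fun=> 1%:E)); last first.
  by move=> x; rewrite inE => -[_]; rewrite /= in_itv/= /uniform_pdf => ->; rewrite subr0 invr1.
by rewrite integral_cst ?mul1e//; exact: measurableI.
Qed.

Lemma uniform01_itv_le (s t : R) : s <= t -> (U01 `[s, t[ <= (t - s)%:E)%E.
Proof.
move=> st; rewrite uniform01E//.
apply: (@le_trans _ _ (lebesgue_measure (`[s, t[%classic : set (measurableTypeR R)))).
  by apply: le_measure; rewrite ?inE//; exact: measurableI.
by rewrite lebesgue_measure_itv/= lte_fin; case: ltP => // _; rewrite lee_fin subr_ge0.
Qed.

Lemma uniform01_ae (Q : R -> Prop) : (forall w, 0 <= w < 1 -> Q w) -> {ae U01, forall w, Q w}.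
Proof.
move=> HQ; exists (~` `[0, 1[%classic); split; first exact: measurableC.
- rewrite uniform01E; last exact: measurableC.
  apply/eqP; rewrite eq_le measure_ge0 andbT.
  rewrite -(lebesgue_measure_set1 (1 : R)); apply: le_measure; rewrite ?inE//.
    by apply: measurableI => //; exact: measurableC.
  move=> w [/=]; rewrite !in_itv/= => /negP + /andP[w0 w1]; rewrite w0/= -leNgt => w1'.
  by apply/eqP; rewrite eq_le w1 w1'.
- by move=> w /= nQ; rewrite in_itv/= => w01; apply: nQ; exact: HQ.
Qed.

Definition first_below (u : nat -> R) (N : nat) (w : R) : nat :=
  find (fun i => u i <= w) (iota 0 N).

Lemma measurable_first_below u N m :
  measurable [set w : measurableTypeR R | first_below u N w = m].
Proof.
rewrite /first_below; elim: (iota 0 N) m => [|i s IH] m /=.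
  by have [->|m0] := eqVneq m 0%N;
    [rewrite (_ : [set w | _] = setT)//; apply/seteqP; split
    |rewrite (_ : [set w | _] = set0)//; apply/seteqP; split => w //= m0'; rewrite m0' eqxx in m0].
have mle : measurable [set w : measurableTypeR R | u i <= w].
  rewrite (_ : [set w | _] = `[u i, +oo[%classic)//.
  by apply/seteqP; split => w /=; rewrite in_itv/= andbT.
case: m => [|m].
  rewrite (_ : [set w | _] = [set w | u i <= w])//.
  by apply/seteqP; split => w /=; case: (u i <= w).
rewrite (_ : [set w | _] = ~` [set w | u i <= w] `&` [set w | find (fun i => u i <= w) s = m]).
  by apply: measurableI; [exact: measurableC|exact: IH].
apply/seteqP; split => w /=; case: (u i <= w) => //=.
- by move=> [->].
- by move=> [].
- by move=> [_ ->].
Qed.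

Lemma measurable_first_below_neq u v N :
  measurable [set w : measurableTypeR R | first_below u N w != first_below v N w].
Proof.
rewrite (_ : [set w | _] = ~` (\bigcup_m ([set w | first_below u N w = m] `&`
    [set w | first_below v N w = m]))).
  apply: measurableC; apply: bigcupT_measurable => m.
  by apply: measurableI; exact: measurable_first_below.
apply/seteqP; split => w /=; first by move=> /eqP uv [m _ [/= um vm]]; apply: uv; rewrite um vm.
by move=> h; apply/eqP => uv; apply: h; exists (first_below u N w).
Qed.

(** The first index below w can only change if w lies between u i and v i for some i. *)
Lemma first_below_neq_le u v N :
  (U01 [set w | first_below u N w != first_below v N w] <= (\sum_(i < N) `|u i - v i|)%:E)%E.
Proof.
pose J i := `[Num.min (u i) (v i), Num.max (u i) (v i)[%classic : set (measurableTypeR R).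
have sub : [set w | first_below u N w != first_below v N w] `<=` \big[setU/set0]_(i < N) J i.
  move=> w /= uv; rewrite -bigcup_mkord.
  apply: contrapT => nJ; move/eqP: uv; apply.
  apply: eq_in_find => i; rewrite mem_iota add0n => /= iN.
  apply/idP/idP => h; apply: contrapT => /negP; rewrite -ltNge => h'; apply: nJ; exists i => //;
    by rewrite /J /= in_itv/= ge_min lt_max h h' ?orbT.
have mJ i : measurable (J i) by exact: measurable_itv.
apply: (@le_trans _ _ (U01 (\big[setU/set0]_(i < N) J i))).
  apply: le_measure; rewrite ?inE//; first exact: measurable_first_below_neq.
  by rewrite -bigcup_mkord; apply: fin_bigcup_measurable.
apply: (le_trans (Boole_inequality _ _)) => //.
rewrite -sumEFin; apply: lee_sum => i _.
apply: le_trans (uniform01_itv_le _) _; first by rewrite ge_min le_max lexx.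
rewrite lee_fin; have := ler_norm (u i - v i); have := ler_norm (v i - u i).
by rewrite (distrC (v i)); case: (leP (u i) (v i)); lra.
Qed.

End random_codes.

(** * Stochastic embedding of a snowflake *)

Section stochastic_embedding.
Context {R : realType} {Z : metricType R} (z0 : Z) (alpha : R) (alpha01 : 0 < alpha < 1).
Context (d : Z -> Z -> R) (d_ge0 : forall x y, 0 <= d x y).
Context (d_sym : forall x y, d x y = d y x).
Context (d_triangle : forall y x z, d x z <= d x y + d y z).
Context (mdistE : forall x y : Z, mdist x y = d x y `^ alpha).
Context (C K : R) (N : nat -> nat) (u : nat -> nat -> Z -> R) (b : nat -> nat -> Z).
Context (C0 : 0 <= C) (K0 : 0 <= K) (cells : cell_system d z0 C K N u b).
Local Notation a := ((2 : R) `^ (- alpha)).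
Local Notation Y := (code_space (halving_ratio01 alpha01)).
Local Notation U01 := (uniform_prob (@ltr01 R)).

Let code (w : measurableTypeR R) (p : Z) : Y := fun k => first_below (fun i => u k i p) (N k) w.

Let a0 : 0 < a. Proof. by case/andP: (halving_ratio01 alpha01). Qed.

Let sep k p q : set (measurableTypeR R) :=
  [set w | first_below (fun i => u k i p) (N k) w != first_below (fun i => u k i q) (N k) w].

Let measurable_sep k p q : measurable (sep k p q).
Proof. exact: measurable_first_below_neq. Qed.

Let sep_prob k p q : (U01 (sep k p q) <= ((K + 1) * Num.min 1 (2 ^+ k * d p q))%:E)%E.
Proof.
have k2 : 0 < 2 ^+ k :> R by rewrite exprn_gt0.
have [dk|dk] := leP (d p q) (2 ^- k).
  have -> : Num.min 1 (2 ^+ k * d p q) = 2 ^+ k * d p q.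
    by apply/min_idPr; rewrite -ler_pdivlMl// mulr1.
  apply: le_trans (first_below_neq_le _ _ _) _; rewrite lee_fin.
  apply: le_trans (cell_variation cells dk) _.
  by rewrite ler_wpM2r ?lerDl// mulr_ge0// ltW.
have -> : Num.min 1 (2 ^+ k * d p q) = 1.
  by apply/min_idPl; rewrite -ler_pdivrMl// mulr1 ltW.
apply: le_trans (probability_le1 _ (measurable_sep k p q)) _.
by rewrite mulr1 lee_fin lerDr.
Qed.

Let expected_distance : exists2 G : R, 0 <= G & forall p q,
  ('E_U01[fun w => mdist (code w p) (code w q)] <= (G * mdist p q)%:E)%E.
Proof.
have [G G0 HG] := snowflake_sum alpha01.
exists ((K + 1) * G) => [|p q]; first by rewrite mulr_ge0// addr_ge0.
apply: (expected_code_distance (e := fun k => (K + 1) * Num.min 1 (2 ^+ k * d p q))).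
- by move=> k; exact: measurable_sep.
- by move=> k; exact: sep_prob.
- move=> n; rewrite mdistE -mulrA; under eq_bigr => k _ do rewrite mulrCA.
  by rewrite -mulr_sumr ler_wpM2l ?addr_ge0// HG.
Qed.

(* The function of the chosen cell is at most w < 1 at p, so p is close to that
   cell; for w = 1 this fails, hence an almost sure statement. *)
Let code_cell (w : R) k p : 0 <= w < 1 ->
  (code w p k < N k)%N /\ d p (b k (code w p k)) <= C * 2 ^- k.
Proof.
move=> /andP[w0 w1]; have [i iN ui] := cell_cover cells k p.
have hs : has (fun i => u k i p <= w) (iota 0 (N k)).
  by apply/hasP; exists i; rewrite ?ui// mem_iota.
have lt : (code w p k < N k)%N by rewrite -[X in (_ < X)%N](size_iota 0) -has_find.
split => //; apply: (cell_close cells lt).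
by have := nth_find 0%N hs; rewrite nth_iota// add0n => /le_lt_trans; apply.
Qed.

Let agree_close (w : R) k p q : 0 <= w < 1 -> code w p k = code w q k ->
  d p q <= 2 * C * 2 ^- k.
Proof.
move=> w01 pq; have [_ h1] := code_cell k p w01; have [_ h2] := code_cell k q w01.
apply: le_trans (d_triangle (b k (code w p k)) _ _) _.
rewrite -mulrA mulr_natl mulr2n lerD//.
by rewrite d_sym pq.
Qed.

Let lower_scale := a / ((2 * C) `^ alpha + 1).

Let code_lower (w : R) p q : 0 <= w < 1 ->
  lower_scale * mdist p q <= mdist (code w p) (code w q).
Proof.
move=> w01; have c0 : 0 < (2 * C) `^ alpha + 1 by rewrite ltr_wpDl ?powR_ge0.
have [al0 _] := andP alpha01.
have bound k : code w p k = code w q k -> lower_scale * mdist p q <= a ^+ k.+1.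
  move=> /(agree_close w01) dk; rewrite exprS -mulrA ler_wpM2l ?(ltW a0)//.
  rewrite ler_pdivrMl// mdistE.
  apply: (@le_trans _ _ ((2 * C) `^ alpha * a ^+ k)).
    rewrite -powR_halfX -powRM ?mulr_ge0 ?invr_ge0 ?exprn_ge0//.
    by rewrite ge0_ler_powR ?nnegrE ?mulr_ge0 ?invr_ge0 ?exprn_ge0 ?(ltW al0).
  by rewrite ler_wpM2r ?lerDl// exprn_ge0// ltW.
case: (code_mdistP (code w p) (code w q)) => [[pq ->]|[[|k] [agr ukv ->]]].
- apply/ler_addgt0Pr => e e0; rewrite add0r.
  have [k ke] := code_geometric_small (halving_ratio01 alpha01) e0.
  rewrite (le_trans (bound k _)) ?pq// (le_trans _ (ltW ke))// exprS ler_piMl ?exprn_ge0 ?(ltW a0)//.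
  by case/andP: (halving_ratio01 alpha01) => _ /ltW.
(* Level 0 has a single cell, so the first difference is never there. *)
- case: ukv; have [] := code_cell 0 p w01; have [] := code_cell 0 q w01.
  by rewrite (cell_N0 cells) !ltnS !leqn0 => /eqP -> _ /eqP -> _.
- exact/bound/agr.
Qed.

Theorem snowflake_stochastic_embeds : exists (Y : metricType R) (y0 : Y),
  ultrametric Y /\ stochastic_embeds z0 y0.
Proof.
exists Y, ((fun=> 0%N) : Y); split; first exact: code_space_ultrametric.
have s0 : 0 < lower_scale by rewrite divr_gt0// ltr_wpDl ?powR_ge0.
have [G G0 HG] := expected_distance.
exists _, (measurableTypeR R), U01, code, (G / lower_scale), lower_scale; split => //; last first.
  move=> p q; split; last by apply: uniform01_ae => w; exact: code_lower.
  by rewrite mulrCA divff ?mulr1 ?gt_eqF.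
split => [p B|p|].
- apply: code_valued_measurable => k m; exact: measurable_first_below.
- exists setT; first exact: code_space_separable.
  by apply: uniform01_ae.
- apply: uniform01_ae => w /andP[w0 _]; apply/funext => k.
  have [i iN _] := cell_cover cells k z0.
  rewrite /code /first_below; case: (N k) iN => // n _ /=.
  by rewrite (cell_base cells) w0.
Qed.

End stochastic_embedding.

(** * Conclusion *)

Theorem theorem2 (R : realType) (X : metricType R) :
  infinite_set [set: X] -> compact [set: X] -> finite_nagata_dim X ->
  forall (alpha : R) (alpha01 : 0 < alpha < 1) (x0 : snowflake X alpha01),
    (exists (Y : metricType R) (y0 : Y),
        ultrametric Y /\ stochastic_embeds x0 y0) /\
    isomorphic (free_space x0) (ell1 R).
Proof.
move=> iX cX nX alpha alpha01 x0.
have [C [K [N [u [b [C0 K0 cells]]]]]] := nagata_cell_system (x0 : X) cX nX.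
pose Z : metricType R := snowflake X alpha01.
pose d (x y : Z) : R := @mdist R X x y.
have d_ge0 x y : 0 <= d x y by exact: mdist_ge0.
have d_sym x y : d x y = d y x by exact: metric_sym.
have d_tri y x z : d x z <= d x y + d y z by exact: metric_triangle.
have mdE (x y : Z) : mdist x y = d x y `^ alpha by exact: snowflake_mdist.
split.
  exact: (@snowflake_stochastic_embeds R Z x0 alpha alpha01 d
    d_ge0 d_sym d_tri mdE C K N u b C0 K0 cells).
have [S [T [bS bT ST]]] :=
  @free_space_retract_ell1 R Z x0 alpha alpha01 d
    d_ge0 d_sym d_tri mdE C K N u b C0 K0 cells.
have [p pacc] := compact_accumulation (x0 : X) iX cX.
have [|A [B [bA bB AB]]] := @ell1_complemented_accumulation R Z x0 p.
  move=> e e0; have [al0 _] := andP alpha01.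
  have [q qp0 qpe] := pacc (e `^ alpha^-1) (powR_gt0 _ e0).
  exists q; rewrite mdE; first exact: powR_gt0.
  rewrite -[leRHS]powRr1 ?(ltW e0)// -(mulVf (lt0r_neq0 al0)) powRrM.
  by rewrite ge0_ler_powR ?nnegrE ?powR_ge0 ?d_ge0 ?(ltW al0) ?(ltW qpe).
exact: (pelczynski_ell1 bS bT bA bB ST AB).
Qed.
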